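(* Let $n\in\mathbb{Z}_{\ge0}$ and $d,l\in\mathbb{Z}_{>0}$, let $K=\mathbb{Q}(\eta_{dl})$ with $\eta_m=\exp(2\pi i/m)$, and let $(r_0,\ldots,r_{l-1},r)\in\mathbb{Z}^{l+1}$. Let $\varphi:K[\mathbf{q},\mathbf{q}^{-1}]\to K[y,y^{-1}]$ be the $K$-algebra morphism with $\varphi(Q_i)=\eta_l^iy^{r_i}$ for $0\le i\le l-1$ and $\varphi(q)=y^r$. Let $\eta\in\mathbb{C}^*$ be algebraic over $K$, let $\Phi$ be its minimal polynomial over $K$, and let $\theta:K[y,y^{-1}]\to K(\eta)$ be the $K$-algebra morphism with $\theta(y)=\eta$. Let $\boldsymbol{\lambda},\boldsymbol{\mu}$ be $dl$-partitions of $n$. If the simple modules $V^{\boldsymbol{\lambda}}$ and $V^{\boldsymbol{\mu}}$ of the specialisation via $\varphi$ of the cyclotomic Yokonuma--Hecke algebra $\mathrm{Y}(d,l,n)$ (over $K(y)$) are in the same $\theta$-block, then they have the same $\Phi$-defect.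
   Context: $\mathbf{q}=(Q_0,\ldots,Q_{l-1};q)$ is a set of $l+1$ indeterminates and $R=\mathbb{Q}[\mathbf{q},\mathbf{q}^{-1}]$. **Cyclotomic Yokonuma--Hecke algebra.** $\mathrm{Y}(d,l,n)$ is the associative unital $R$-algebra with generators $g_1,\ldots,g_{n-1},t_1,\ldots,t_n,X_1$ and relations: $g_ig_j=g_jg_i$ for $|i-j|>1$; $g_ig_{i+1}g_i=g_{i+1}g_ig_{i+1}$ for $1\le i\le n-2$; $t_it_j=t_jt_i$; $g_it_j=t_{s_i(j)}g_i$ where $s_i$ is the transposition $(i,i+1)$; $t_j^d=1$; $g_i^2=q+(q-1)e_ig_i$ with $e_i=\frac1d\sum_{0\le s\le d-1}t_i^st_{i+1}^{-s}$; $X_1g_1X_1g_1=g_1X_1g_1X_1$; $X_1g_i=g_iX_1$ for $2\le i\le n-1$; $X_1t_j=t_jX_1$ for $1\le j\le n$; $(X_1-Q_0)\cdots(X_1-Q_{l-1})=0$. **Ariki--Koike algebra.** $\mathcal{H}_m^{\mathbf{q}}$ is the algebra with generators $T_0,\ldots,T_{m-1}$ and relations $\prod_{i=0}^{l-1}(T_0-Q_i)=0$; $(T_i-q)(T_i+1)=0$ for $i\ge1$; $T_0T_1T_0T_1=T_1T_0T_1T_0$; $T_iT_{i+1}T_i=T_{i+1}T_iT_{i+1}$ for $1\le i\le m-2$; $T_iT_j=T_jT_i$ for $j-i>1$. Over the field of fractions its simple modules $V^{\boldsymbol{\nu}}$ are labelled in the standard way by $l$-partitions $\boldsymbol{\nu}$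 of $m$ ($V^{\boldsymbol{\nu}}$ has a basis indexed by standard tableaux of shape $\boldsymbol{\nu}$ on which $L_1=T_0$, $L_{k+1}=q^{-1}T_kL_kT_k$ act diagonally, $L_k$ with eigenvalue $q^{j-i}Q_a$ if $k$ is in row $i$, column $j$ of component $a$). **Simple modules.** After extending scalars to contain $\eta_d$, there is an algebra isomorphism $$\mathrm{Y}(d,l,n)\cong\bigoplus_{n_1+\cdots+n_d=n,\ n_i\ge0}\mathrm{Mat}_{\frac{n!}{n_1!\cdots n_d!}}\big(\mathcal{H}_{n_1}^{\mathbf{q}}\otimes\cdots\otimes\mathcal{H}_{n_d}^{\mathbf{q}}\big).$$ For a $dl$-partition $\boldsymbol{\lambda}=(\lambda^0,\ldots,\lambda^{dl-1})$ of $n$ (a $dl$-tuple of partitions of total size $n$) put $\boldsymbol{\lambda}[i]=(\lambda^{(i-1)l},\ldots,\lambda^{il-1})$ for $1\le i\le d$, an $l$-partition of size $n_i=|\boldsymbol{\lambda}[i]|$. The simple $K(\mathbf{q})\mathrm{Y}(d,l,n)$-modules are the $V^{\boldsymbol{\lambda}}$, where $V^{\boldsymbol{\lambda}}$ corresponds under the isomorphism to $V^{\boldsymbol{\lambda}[1]}\otimes\cdots\otimes V^{\boldsymbol{\lambda}[d]}$. Specialisation via $\varphi$ gives an algebra $\mathrm{Y}_\varphi$ over $K[y,y^{-1}]$ such that $K(y)\mathrm{Y}_\varphi$ is split semisimple, with simple modules labelled correspondingly. **Schur elements and defect.** For partitions $\lambda,\mu$ with conjugates $\lambda',\mu'$ and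 a node $(i,j)$ of $\lambda$ (set of nodes $[\lambda]$), let $h_{i,j}^{\lambda,\mu}=\lambda_i-i+\mu'_j-j+1$; $N(\lambda)=\sum_{i\ge1}(i-1)\lambda_i$; $[k]_q=1+q+\cdots+q^{k-1}$. For an $l$-partition $\boldsymbol{\nu}$ of $m$, with $\bar{\boldsymbol{\nu}}$ the partition obtained by reordering all its parts, $$s_{\boldsymbol{\nu}}(\mathbf{q})=(-1)^{m(l-1)}q^{-N(\bar{\boldsymbol{\nu}})}\prod_{a=0}^{l-1}\ \prod_{(i,j)\in[\nu^a]}\Big([h_{i,j}^{\nu^a,\nu^a}]_q\prod_{b\ne a}\big(q^{h_{i,j}^{\nu^a,\nu^b}}Q_aQ_b^{-1}-1\big)\Big).$$ The Schur element of $V^{\boldsymbol{\lambda}}\in\mathrm{Irr}(K(\mathbf{q})\mathrm{Y}(d,l,n))$, with respect to the standard symmetrising trace on $\mathrm{Y}(d,l,n)$, is $d^n\prod_{i=1}^ds_{\boldsymbol{\lambda}[i]}(\mathbf{q})$. With $\nu_\Phi$ the $\Phi$-adic valuation on $K(y)$, the $\Phi$-defect of $V^{\boldsymbol{\lambda}}$ is $\nu_\Phi\big(\varphi(d^n\prod_is_{\boldsymbol{\lambda}[i]}(\mathbf{q}))\big)=\sum_{i=1}^d\nu_\Phi(\varphi(s_{\boldsymbol{\lambda}[i]}(\mathbf{q})))$. **$\theta$-blocks.** Let $\mathcal{O}\subset K(y)$ be the localisation of $K[y,y^{-1}]$ at $\mathrm{Ker}\,\theta=(\Phi)$, with residue field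 $K(\eta)$. For a simple $K(y)\mathrm{Y}_\varphi$-module $V$ choose an $\mathcal{O}\mathrm{Y}_\varphi$-lattice $V_{\mathcal{O}}$ with $K(y)\otimes_{\mathcal{O}}V_{\mathcal{O}}\cong V$; for a simple $K(\eta)\mathrm{Y}_\varphi$-module $M$ the decomposition number $[V:M]$ is the multiplicity of $M$ as a composition factor of $K(\eta)\otimes_{\mathcal{O}}V_{\mathcal{O}}$. The Brauer graph has vertex set $\mathrm{Irr}(K(y)\mathrm{Y}_\varphi)$, with $V,V'$ joined by an edge if some $M$ satisfies $[V:M]\ne0\ne[V':M]$. Its connected components are the $\theta$-blocks. *)

(* Defs.v *)
From HB Require Import structures.
From Stdlib Require Import Relation_Operators.
From mathcomp Require Import all_boot all_order all_fingroup all_algebra all_field.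
From mathcomp Require Import boolp classical_sets reals trigo.
From mathcomp.real_closed Require Import complex.
(* The notations of mpoly clash with those of the analysis library. *)
From mathcomp.multinomials Require Import -(notations) mpoly.

Set Implicit Arguments.
Unset Strict Implicit.
Unset Printing Implicit Defensive.

Import Order.TTheory GRing.Theory Num.Theory.
Local Open Scope ring_scope.

Definition exp2pi (R : realType) (m : nat) : R[i] :=
  (cos (2 * trigo.pi / m%:R) +i* sin (2 * trigo.pi / m%:R))%C.

(** * Multipartitions

    A partition is the decreasing sequence of its nonzero parts.  Everything
    is indexed from 0: the row i and column j of a node are, with the usual
    conventions, its row i+1 and column j+1. *)

Definition is_partition (p : seq nat) : bool := sorted geq p && (0 \notin p)%N.

Definition msum (nu : seq (seq nat)) : nat := sumn [seq sumn p | p <- nu].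

Definition is_multipartition (k n : nat) (nu : seq (seq nat)) : bool :=
  [&& size nu == k, all is_partition nu & msum nu == n].

Definition part (nu : seq (seq nat)) (a : nat) : seq nat := nth [::] nu a.

(* lambda[i+1], for 0 <= i < d. *)
Definition mblock (l : nat) (lam : seq (seq nat)) (i : nat) : seq (seq nat) :=
  take l (drop (i * l)%N lam).

(* n_1 + ... + n_i, where n_i is the size of lambda[i]. *)
Definition moffset (l : nat) (lam : seq (seq nat)) (i : nat) : nat :=
  (\sum_(k < i) msum (mblock l lam k))%N.

Definition part_nodes (p : seq nat) : seq (nat * nat) :=
  [seq (i, j) | i <- iota 0 (size p), j <- iota 0 (nth 0%N p i)].

(* The node (i, j) of the a-th component is (a, (i, j)). *)
Definition node := (nat * (nat * nat))%type.

Definition nodes (nu : seq (seq nat)) : seq node :=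
  [seq (a, x) | a <- iota 0 (size nu), x <- part_nodes (part nu a)].

(* A tableau of shape nu is the list of the nodes of nu, in the order given by
   their entries: its k-th item is the node that contains k+1. *)
Definition standard (s : seq node) : bool :=
  all2rel (fun x y : node =>
    [&& x.1 == y.1, x.2.1 <= y.2.1 & x.2.2 <= y.2.2]%N
      ==> (index x s <= index y s)%N) s.

Definition std_tableaux (nu : seq (seq nat)) : seq (seq node) :=
  [seq s <- permutations (nodes nu) | standard s].

Definition content (F : fieldType) (q : F) (Q : nat -> F) (x : node) : F :=
  q ^ (x.2.2%:Z - x.2.1%:Z) * Q x.1.

(** * Schur elements *)

Definition conj_part (p : seq nat) (j : nat) : nat := count (fun x => j < x)%N p.

(* lambda_i - i + mu'_j - j + 1 becomes this when i and j start from 0. *)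
Definition hook (lam mu : seq nat) (i j : nat) : int :=
  (nth 0%N lam i)%:Z - i%:Z + (conj_part mu j)%:Z - j%:Z - 1.

Definition Nstat (p : seq nat) : nat := (\sum_(i < size p) i * nth 0 p i)%N.

Definition qint (F : fieldType) (q : F) (k : nat) : F := \sum_(s < k) q ^+ s.

(* hook lam lam i j is positive at a node of lam, so absz does not alter it. *)
Definition ak_schur (F : fieldType) (q : F) (Q : nat -> F) (l : nat)
    (nu : seq (seq nat)) : F :=
  (-1) ^+ (msum nu * (l - 1)) * q ^- Nstat (sort geq (flatten nu)) *
  \prod_(a < l) \prod_(x <- part_nodes (part nu a))
    (qint q (absz (hook (part nu a) (part nu a) x.1 x.2)) *
     \prod_(b < l | b != a)
       (q ^ hook (part nu a) (part nu b) x.1 x.2 * Q a * (Q b)^-1 - 1)).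

Definition yh_schur (F : fieldType) (q : F) (Q : nat -> F) (d l n : nat)
    (lam : seq (seq nat)) : F :=
  d%:R ^+ n * \prod_(i < d) ak_schur q Q l (mblock l lam i).

(** * Modules over algebras given by generators

    A finite-dimensional left module over an F-algebra presented by generators
    in G is a family of matrices, acting on column vectors, which satisfy the
    defining relations. *)

Record rep (F : fieldType) (G : Type) :=
  Rep { rdim : nat; ract :> G -> 'M[F]_rdim }.

Section Modules.
Variables (F : fieldType) (G : Type).
Implicit Types V W M : rep F G.

Definition submodule V (U : {vspace 'cV[F]_(rdim V)}) : Prop :=
  forall x u, u \in U -> V x *m u \in U.

Definition is_simple V : Prop :=
  (0 < rdim V)%N /\
  forall U : {vspace 'cV[F]_(rdim V)},
    submodule U -> U = 0%VS \/ U = fullv.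

Definition rep_iso V W : Prop :=
  exists (B : 'M[F]_(rdim V, rdim W)) (C : 'M[F]_(rdim W, rdim V)),
    [/\ B *m C = 1%:M, C *m B = 1%:M & forall x, V x *m B = B *m W x].

Definition composition_series V (s : seq {vspace 'cV[F]_(rdim V)}) : Prop :=
  last 0%VS s = fullv /\
  forall i, (i < size s)%N ->
    let U := nth 0%VS (0%VS :: s) i in let U' := nth 0%VS s i in
    [/\ submodule U', (U <= U')%VS, U <> U' &
      forall Z : {vspace 'cV[F]_(rdim V)},
        submodule Z -> (U <= Z)%VS -> (Z <= U')%VS -> Z = U \/ Z = U'].

Definition quotient_iso V (U U' : {vspace 'cV[F]_(rdim V)}) M : Prop :=
  exists f : 'Hom('cV[F]_(rdim V), 'cV[F]_(rdim M)),
    [/\ (f @: U')%VS = fullv, (U' :&: lker f)%VS = U &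
      forall x u, u \in U' -> f (V x *m u) = M x *m f u].

Definition multiplicity V (s : seq {vspace 'cV[F]_(rdim V)}) M : nat :=
  (\sum_(i < size s)
     `[< quotient_iso (nth 0%VS (0%VS :: s) i) (nth 0%VS s i) M >])%N.

Definition rep_word V (w : seq G) : 'M[F]_(rdim V) :=
  foldr (fun x A => V x *m A) 1%:M w.

End Modules.

(** * Specialisation

    A morphism f from a domain A to a field k extends to the localisation of A
    at Ker f, a subring of the field of fractions of A. *)

Section Specialisation.
Variables (A : idomainType) (k : fieldType) (f : A -> k).

Definition specialises (x : {fraction A}) (z : k) : Prop :=
  exists a b : A, [/\ f b != 0, x = tofrac a / tofrac b & z = f a / f b].

(* The extension of f, with value 0 outside of the localisation. *)
Definition specialise (x : {fraction A}) : k :=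
  xget 0 [set z | specialises x z]%classic.

(* W is the reduction of a lattice in V, free over the localisation of A. *)
Definition reduction (G : Type) (V : rep {fraction A} G) (W : rep k G) : Prop :=
  exists S : G -> 'M[{fraction A}]_(rdim W),
    rep_iso V (Rep S) /\ forall x i j, specialises (S x i j) (W x i j).

(* When the localisation is a discrete valuation ring, this does not depend on
   the choice of the lattice nor on that of the composition series. *)
Definition decomposition_number (G : Type) (V : rep {fraction A} G)
    (M : rep k G) : nat :=
  xget 0%N [set m | exists W, reduction V W /\
    exists s : seq {vspace 'cV[k]_(rdim W)},
      composition_series s /\ m = multiplicity s M]%classic.

End Specialisation.

(** * Ariki-Koike and cyclotomic Yokonuma-Hecke algebras *)

Section Algebras.
Variables (F : fieldType) (q : F) (Q : nat -> F) (d l : nat).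

Definition braid_relations (m N : nat) (T : 'I_m -> 'M[F]_N) : Prop :=
  [/\ forall i : 'I_m, i = 0%N :> nat -> \prod_(a < l) (T i - (Q a)%:M) = 0,
      forall i j : 'I_m, (i.+1 < j)%N -> T i *m T j = T j *m T i,
      forall i j : 'I_m, (0 < i)%N -> j = i.+1 :> nat ->
        T i *m T j *m T i = T j *m T i *m T j
    & forall i j : 'I_m, i = 0%N :> nat -> j = 1%N :> nat ->
        T i *m T j *m T i *m T j = T j *m T i *m T j *m T i].

Definition ak_module (m : nat) (W : rep F 'I_m) : Prop :=
  braid_relations W /\
  forall i : 'I_m, (0 < i)%N -> (W i - q%:M) *m (W i + 1%:M) = 0.

(* Yg 0 is X_1 and Yg i is g_i for i > 0; Yt j is t_(j+1).  There is no
   generator when n = 0, so that Y(d, l, 0) is the ground ring, like the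
   Ariki-Koike algebra with m = 0. *)
Inductive yh_gen (n : nat) := Yg of 'I_n | Yt of 'I_n.

(* As t_(i+1)^d = 1, the power t_(i+1)^(d - s) is t_(i+1)^(-s). *)
Definition yh_e (n : nat) (V : rep F (yh_gen n)) (i : 'I_n) : 'M[F]_(rdim V) :=
  d%:R^-1 *: \sum_(s < d) (V (Yt (ord_pred i)) ^+ s *m V (Yt i) ^+ (d - s)).

(* With T_0 = X_1 and T_i = g_i, the relations of X_1 and the g_i which do not
   involve the t_j, other than the quadratic ones, are those of the
   Ariki-Koike algebra. *)
Definition yh_module (n : nat) (V : rep F (yh_gen n)) : Prop :=
  [/\ braid_relations (fun i : 'I_n => V (Yg i)),
      forall i j : 'I_n, V (Yt i) *m V (Yt j) = V (Yt j) *m V (Yt i),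
      forall j : 'I_n, V (Yt j) ^+ d = 1%:M,
      forall i j : 'I_n, V (Yg i) *m V (Yt j) =
        V (Yt (if (0 < i)%N then tperm (ord_pred i) i j else j)) *m V (Yg i)
    & forall i : 'I_n, (0 < i)%N ->
        V (Yg i) *m V (Yg i) = q%:M + (q - 1) *: (yh_e V i *m V (Yg i))].

Definition at_nat (m N : nat) (T : 'I_m -> 'M[F]_N) (k : nat) : 'M[F]_N :=
  if insub k is Some i then T i else 1%:M.

(* The Jucys-Murphy element L_(k+1), or X_(k+1), of T_0, T_1, ... *)
Fixpoint jucys_murphy (N : nat) (T : nat -> 'M[F]_N) (k : nat) : 'M[F]_N :=
  if k is k'.+1 then q^-1 *: (T k *m jucys_murphy T k' *m T k) else T 0%N.

(* W is V^nu: it has a basis indexed by the standard tableaux of shape nu on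
   which the L_k act diagonally, by contents. *)
Definition ak_labelled (nu : seq (seq nat)) (m : nat) (W : rep F 'I_m) : Prop :=
  [/\ ak_module W, is_simple W &
    exists b : seq node -> 'cV[F]_(rdim W),
      basis_of fullv [seq b s | s <- std_tableaux nu] /\
      forall s, s \in std_tableaux nu -> forall k, (k < m)%N ->
        jucys_murphy (at_nat W) k *m b s =
        content q Q (nth (0, (0, 0))%N s k) *: b s].

(* The isomorphism of Y(d, l, n) with a sum of matrix algebras maps, for each
   (n_1, ..., n_d), a diagonal matrix unit to the idempotent that projects onto
   the vectors on which t_j acts by the (i+1)-th of the d-th roots of unity
   1, zd, ..., zd^(d-1) if n_1 + ... + n_i < j <= n_1 + ... + n_(i+1). *)
Definition weight_vector (zd : F) (lam : seq (seq nat)) (n : nat)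
    (V : rep F (yh_gen n)) (u : 'cV[F]_(rdim V)) : Prop :=
  forall (i : 'I_d) (j : 'I_n),
    (moffset l lam i <= j < moffset l lam i.+1)%N ->
    V (Yt j) *m u = zd ^+ i *: u.

(* On these vectors the generators T_0 and T_k of the tensor factor H_(n_(i+1))
   act by X_(o+1) and g_(o+k), where o = n_1 + ... + n_i. *)
Definition factor_act (n : nat) (V : rep F (yh_gen n)) (o k : nat) :
    'M[F]_(rdim V) :=
  let g := at_nat (fun i : 'I_n => V (Yg i)) in
  if k is 0%N then jucys_murphy g o else g (o + k)%N.

(* V is V^lambda: the matrix algebras are Morita equivalent to the tensor
   products of Ariki-Koike algebras, so V corresponds to the module on its
   weight vectors.  The family v gives the isomorphism of the tensor product of
   the V^lambda[i] with that module: v beta is the image of the tensor product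
   of the vectors of index beta i of the canonical bases. *)
Definition yh_labelled (zd : F) (lam : seq (seq nat)) (n : nat)
    (V : rep F (yh_gen n)) : Prop :=
  [/\ yh_module V, is_simple V &
    exists W : forall i : 'I_d, rep F 'I_(msum (mblock l lam i)),
      (forall i : 'I_d, ak_labelled (mblock l lam i) (W i)) /\
      exists v : {dffun forall i : 'I_d, 'I_(rdim (W i))} -> 'cV[F]_(rdim V),
        let X := [seq v beta | beta <- enum predT] in
        [/\ free X,
            forall u, u \in <<X>>%VS <-> weight_vector zd lam u
          & forall (i : 'I_d) (k : 'I_(msum (mblock l lam i)))
              (beta : {dffun forall i : 'I_d, 'I_(rdim (W i))}),
              factor_act V (moffset l lam i) k *m v beta =
              \sum_(c < rdim (W i))
                W i k c (beta i) *: v (finfun (dfwith beta c))]].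

End Algebras.

(** * The specialisations phi and theta

    zeta is eta_dl, so that eta_l = zeta^d and eta_d = zeta^l. *)

Section Cyclotomic.
Variables (K : fieldExtType rat) (L : fieldExtType K) (zeta : K) (etaL : L).
Variables (d l n : nat) (rr : l.-tuple int) (r : int).

Definition Kq : fieldType := {fraction mpoly l.+1 K}.
Definition Ky : fieldType := {fraction {poly K}}.

(* The l+1 indeterminates are Q_0, ..., Q_(l-1) and, last, q. *)
Definition genQ (a : nat) : Kq := tofrac (mpolyX K (mnm1 (inord a : 'I_l.+1))).
Definition genq : Kq := genQ l.
Definition gen_zd : Kq := tofrac (mpolyC l.+1 (zeta ^+ l)).

Definition phiQ (a : nat) : Ky :=
  tofrac ((zeta ^+ d) ^+ a)%:P * (tofrac 'X) ^ rr`_a.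
Definition phiq : Ky := (tofrac 'X) ^ r.
Definition phi (p : mpoly l.+1 K) : Ky :=
  mmap (fun c => tofrac c%:P)
       (fun a : 'I_l.+1 => if (a < l)%N then phiQ a else phiq) p.

(* theta (phi Q_a) and theta (phi q). *)
Definition thetaQ (a : nat) : L := ((zeta ^+ d) ^+ a)%:A * etaL ^ rr`_a.
Definition thetaq : L := etaL ^ r.
Definition theta (p : {poly K}) : L := (map_poly (in_alg L) p).[etaL].

(* V is the module over the specialised algebra with the same label as V^lambda:
   its character is the specialisation of that of V^lambda. *)
Definition phi_labelled (lam : seq (seq nat)) (V : rep Ky (yh_gen n)) : Prop :=
  [/\ yh_module phiq phiQ d l V, is_simple V &
    exists V0 : rep Kq (yh_gen n),
      yh_labelled genq genQ d l gen_zd lam V0 /\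
      forall w, specialises phi (\tr (rep_word V0 w)) (\tr (rep_word V w))].

Definition brauer_edge (V V' : rep Ky (yh_gen n)) : Prop :=
  [/\ yh_module phiq phiQ d l V /\ is_simple V,
      yh_module phiq phiQ d l V' /\ is_simple V'
    & exists M : rep L (yh_gen n),
        [/\ yh_module thetaq thetaQ d l M, is_simple M,
            decomposition_number theta V M != 0%N
          & decomposition_number theta V' M != 0%N]].

Definition same_theta_block : rep Ky (yh_gen n) -> rep Ky (yh_gen n) -> Prop :=
  clos_refl_sym_trans _ brauer_edge.

(* The Phi-adic valuation, for Phi irreducible; it is 0, instead of being
   infinite, at 0. *)
Definition valuation (Phi : {poly K}) (x : Ky) : int :=
  xget 0 [set k : int | exists a b : {poly K},
    [/\ ~~ (Phi %| a), ~~ (Phi %| b)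
      & x = (tofrac Phi) ^ k * tofrac a / tofrac b]]%classic.

Definition defect (Phi : {poly K}) (lam : seq (seq nat)) : int :=
  valuation Phi (specialise phi (yh_schur genq genQ d l n lam)).

End Cyclotomic.

(* Main.v *)
Require Import Defs.
From HB Require Import structures.
From mathcomp Require Import all_boot all_order all_fingroup all_algebra all_field.
From mathcomp Require Import boolp classical_sets reals trigo.
From mathcomp.real_closed Require Import complex.
From mathcomp.multinomials Require Import -(notations) mpoly.
From mathcomp Require Import zify ring lra.

(** Two modules in the same block have compatible central characters, and the
    defect of V^lambda can be read off its central character.

    Central characters.  Let X_1, ..., X_n be the Jucys-Murphy elements.  The
    sums of the X_k^m t_k^s over k are central: g_k exchanges X_k and X_(k+1) up
    to a multiple of e_k, and e_k does not distinguish t_k from t_(k+1)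
    ([color_power_sum_g]).  On V^lambda such a sum acts by the sum, over the
    nodes x of lambda, of content(x)^m colour(x)^s, where the nodes of lambda[i]
    have as colour a d-th root of unity that depends on i
    ([central_mx_labelled]).  If a central element acts on V by a scalar, it acts
    on the composition factors of a reduction of V by the reduction of that
    scalar ([central_mx_decomposition]), so these reductions are constant along
    the paths of the Brauer graph.  A path visits arbitrary simple modules, on
    which central elements might act by elements of a proper extension of K(y),
    whose reductions would not be well defined; this does not happen, because the
    X_k and the t_k have a common eigenvector with eigenvalues in K(y)
    ([joint_eigenvector_exists]).  Since power sums determine multisets in
    characteristic 0, lambda[i] and mu[i] have the same residues, that is, the
    same images of contents under theta, for every i ([same_block_residues]).

    Defect.  After applying phi, the Schur element is, up to units, a product of
    binomials c y^N - 1 with c a root of unity, divided by powers of y^r - 1 if r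
    is not 0.  The roots of the binomials are simple, so that their valuations are
    1 or 0 according as theta kills them or not.  The defect is thus a number of
    triples (a, b, x), for each nu = lambda[i]: those with x a node of nu^a such
    that q^h Q_a and Q_b have the same image under theta, where h is the hook
    length of x with respect to nu^a and nu^b.  When theta maps q to 1, the number
    of nodes has to be subtracted ([has_valuation_ak_schur]).  This depends only on
    the residues, by an identity between the hook lengths and the contents of two
    partitions, in which the hook lengths of each with respect to the other appear
    together ([hook_content_sums]).  Summing it over the ordered pairs of
    components counts every triple twice ([hook_weight_residues]). *)

Set Implicit Arguments.
Unset Strict Implicit.
Unset Printing Implicit Defensive.

Import Order.TTheory GRing.Theory Num.Theory.
Local Open Scope ring_scope.

(** * Hook lengths and contents *)

Section HookIdentity.
Implicit Types (f F : int -> int) (la mu : seq nat).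

Lemma big_part_nodes (V : zmodType) la (N : nat) (G : nat -> nat -> V) :
  (size la <= N)%N ->
  \sum_(x <- part_nodes la) G x.1 x.2 =
  \sum_(i < N) \sum_(j < nth 0%N la i) G i j.
Proof.
move=> leN; rewrite /part_nodes big_allpairs_dep /=.
rewrite -(subnKC leN) big_split_ord /= [X in _ = _ + X]big1 ?addr0 => [|i _].
  have iotaE m : iota 0 m = index_iota 0 m by rewrite /index_iota subn0.
  by rewrite iotaE big_mkord; apply: eq_bigr => i _; rewrite iotaE big_mkord.
by rewrite nth_default ?leq_addr // big_ord0.
Qed.

Lemma conj_partP mu p k : is_partition mu -> (p < nth 0 mu k)%N = (k < conj_part mu p)%N.
Proof.
case/andP=> mus _; rewrite /conj_part; elim: mu k mus => [|a mu IH] k /=.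
  by rewrite nth_nil.
move=> mus; have mus' := path_sorted mus.
case: (ltnP p a) => pa; first by case: k => [|k] //=; rewrite IH.
have all0 : all (fun x => ~~ (p < x)%N) mu.
  apply/allP => x xmu; rewrite -leqNgt.
  by apply: leq_trans pa; apply: (allP (order_path_min (rev_trans leq_trans) mus)).
have -> : count (fun x => p < x)%N mu = 0%N.
  by apply/eqP; rewrite -leqn0 leqNgt -has_count -all_predC.
case: k => [|k] /=; first by rewrite ltnNge pa.
apply/negbTE; case: (ltnP k (size mu)) => ks; last by rewrite nth_default.
by apply: (allP all0); apply: mem_nth.
Qed.

(** The integers j - mu'_j, for the columns j, and mu_k - k - 1, for the rows k,
    are distinct and fill an interval: they are the two kinds of steps of the
    boundary of mu.  Cutting the rows of mu at p keeps its first p columns. *)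
Lemma sum_conj_part F mu (N p : nat) : is_partition mu -> (size mu <= N)%N ->
  \sum_(j < p) F (j%:Z - (conj_part mu j)%:Z) +
  \sum_(k < N) F ((minn (nth 0%N mu k) p)%:Z - k%:Z - 1) =
  \sum_(u < p + N) F (u%:Z - N%:Z).
Proof.
move=> pmu leN; elim: p => [|p IH].
  rewrite big_ord0 add0r add0n (reindex_inj rev_ord_inj) /=.
  apply: eq_bigr => u _; congr (F _); have := ltn_ord u; lia.
rewrite addSn big_ord_recr /= [RHS]big_ord_recr /= -IH -!addrA; congr (_ + _).
have cN : (conj_part mu p <= N)%N by apply: leq_trans leN; apply: count_size.
have -> : (p + N)%:Z - N%:Z = p%:Z by lia.
have tele (m : nat) : \sum_(k < m) (F (p%:Z - k%:Z) - F (p%:Z - k%:Z - 1)) =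
    F p%:Z - F (p%:Z - m%:Z).
  elim: m => [|m IHm]; first by rewrite big_ord0 subr0 subrr.
  rewrite big_ord_recr /= IHm (_ : p%:Z - m%:Z - 1 = p%:Z - m.+1%:Z); last by lia.
  by ring.
suff : \sum_(k < N) F ((minn (nth 0%N mu k) p.+1)%:Z - k%:Z - 1) =
       \sum_(k < N) F ((minn (nth 0%N mu k) p)%:Z - k%:Z - 1) +
       (F p%:Z - F (p%:Z - (conj_part mu p)%:Z)) by move=> ->; ring.
rewrite -tele (big_ord_widen _ (fun k : nat => F (p%:Z - k%:Z) - F (p%:Z - k%:Z - 1)) cN).
rewrite [X in _ + X]big_mkcond -big_split /=; apply: eq_bigr => k _.
rewrite -conj_partP //; case: ltnP => h.
  rewrite (minn_idPr h) (_ : p.+1%:Z - k%:Z - 1 = p%:Z - k%:Z).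
    by rewrite addrC subrK.
  by lia.
by rewrite addr0 (minn_idPl (leqW h)).
Qed.

(** The hook lengths of a row of la are differences with the column steps of mu,
    which are the complement of its row steps in an interval. *)
Lemma sum_row_hooks f la mu (N i : nat) : is_partition mu -> (size mu <= N)%N ->
  \sum_(j < nth 0%N la i) f (hook la mu i j) +
  \sum_(k < N) f ((nth 0%N la i)%:Z - (minn (nth 0%N mu k) (nth 0%N la i))%:Z + (k%:Z - i%:Z)) =
  \sum_(j < nth 0%N la i) f (j%:Z - i%:Z) +
  \sum_(k < N) f ((nth 0%N la i)%:Z + k%:Z - i%:Z).
Proof.
move=> pmu leN; set p := nth _ la i.
have := sum_conj_part (fun x => f (p%:Z - i%:Z - 1 - x)) p pmu leN.
rewrite (reindex_inj rev_ord_inj) [RHS](reindex_inj rev_ord_inj) /=.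
rewrite [RHS]big_split_ord /= => E.
transitivity (\sum_(j < p) f (p%:Z - i%:Z - 1 - ((p - j.+1)%:Z - (conj_part mu (p - j.+1))%:Z)) +
      \sum_(k < N) f (p%:Z - i%:Z - 1 - ((minn (nth 0%N mu k) p)%:Z - k%:Z - 1))).
  congr (_ + _); last by apply: eq_bigr => k _; congr (f _); lia.
  rewrite (reindex_inj rev_ord_inj) /=; apply: eq_bigr => j _; congr f.
  by rewrite /hook -/p; lia.
rewrite E; congr (_ + _); apply: eq_bigr => j _; congr f; have := ltn_ord j; lia.
Qed.

(** Second differences over a rectangle telescope to its corners. *)
Lemma sum_rectangle f (p p' : nat) (s : int) :
  \sum_(j < p) \sum_(j' < p')
    (f (j%:Z - j'%:Z + s) *+ 2 - f (j%:Z - j'%:Z + s + 1) - f (j%:Z - j'%:Z + s - 1)) =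
  f s + f (p%:Z - p'%:Z + s) - f (p%:Z + s) - f (s - p'%:Z).
Proof.
have row (j : int) : \sum_(j' < p') (f (j - j'%:Z + s) *+ 2 - f (j - j'%:Z + s + 1) -
      f (j - j'%:Z + s - 1)) = f (j + s) - f (j + 1 + s) - f (j - p'%:Z + s)
      + f (j + 1 - p'%:Z + s).
  elim: p' => [|m IH]; first by rewrite big_ord0 !subr0; ring.
  rewrite big_ord_recr /= IH.
  rewrite (_ : j - m%:Z + s + 1 = j + 1 - m%:Z + s); last by ring.
  rewrite (_ : j - m%:Z + s - 1 = j - m.+1%:Z + s); last by lia.
  rewrite (_ : j + 1 - m.+1%:Z + s = j - m%:Z + s); last by lia.
  by ring.
under eq_bigr => j _ do rewrite row.
elim: p => [|p IH]; first by rewrite big_ord0 !add0r (addrC (- _)); ring.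
rewrite big_ord_recr /= IH (_ : p.+1%:Z = p%:Z + 1); last by lia.
by ring.
Qed.

Definition ncontent (x : nat * nat) : int := x.2%:Z - x.1%:Z.

(** For f k = t^k, this is a relation between generating functions.  A row of la
    of length p and a row of mu of length p' leave, on the side of the hook
    lengths, f (p - min p p' + s) and f (min p p' - p' + s).  One of them is f s
    and the other f (p - p' + s), two of the corners of [sum_rectangle]. *)
Theorem hook_content_sums f la mu : is_partition la -> is_partition mu ->
  \sum_(x <- part_nodes la) f (hook la mu x.1 x.2) +
  \sum_(y <- part_nodes mu) f (- hook mu la y.1 y.2) =
  \sum_(x <- part_nodes la) f (ncontent x) +
  \sum_(y <- part_nodes mu) f (- ncontent y) -
  \sum_(x <- part_nodes la) \sum_(y <- part_nodes mu)
    (f (ncontent x - ncontent y) *+ 2 - f (ncontent x - ncontent y + 1)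
     - f (ncontent x - ncontent y - 1)).
Proof.
move=> pla pmu; pose N := maxn (size la) (size mu).
have lN : (size la <= N)%N by apply: leq_maxl.
have mN : (size mu <= N)%N by apply: leq_maxr.
rewrite !(big_part_nodes (fun i j => f (hook la mu i j)) lN).
rewrite !(big_part_nodes (fun i j => f (- hook mu la i j)) mN).
rewrite (big_part_nodes (fun i j => f (j%:Z - i%:Z)) lN).
rewrite (big_part_nodes (fun i j => f (- (j%:Z - i%:Z))) mN).
rewrite (big_part_nodes (fun i j => \sum_(y <- part_nodes mu)
  (f (j%:Z - i%:Z - ncontent y) *+ 2 - f (j%:Z - i%:Z - ncontent y + 1)
     - f (j%:Z - i%:Z - ncontent y - 1))) lN).
pose l i := (nth 0 la i)%N; pose m i := (nth 0 mu i)%N.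
have dbl : \sum_(i < N) \sum_(j < l i) \sum_(y <- part_nodes mu)
    (f (j%:Z - i%:Z - ncontent y) *+ 2 - f (j%:Z - i%:Z - ncontent y + 1)
     - f (j%:Z - i%:Z - ncontent y - 1)) =
  \sum_(i < N) \sum_(k < N) (f (k%:Z - i%:Z) + f ((l i)%:Z - (m k)%:Z + (k%:Z - i%:Z))
     - f ((l i)%:Z + k%:Z - i%:Z) - f (- ((m k)%:Z + i%:Z - k%:Z))).
  apply: eq_bigr => i _.
  transitivity (\sum_(j < l i) \sum_(k < N) \sum_(j' < m k)
    (f (j%:Z - j'%:Z + (k%:Z - i%:Z)) *+ 2 - f (j%:Z - j'%:Z + (k%:Z - i%:Z) + 1)
     - f (j%:Z - j'%:Z + (k%:Z - i%:Z) - 1))).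
    apply: eq_bigr => j _.
    rewrite (big_part_nodes (fun k j' => f (j%:Z - i%:Z - (j'%:Z - k%:Z)) *+ 2 -
      f (j%:Z - i%:Z - (j'%:Z - k%:Z) + 1) - f (j%:Z - i%:Z - (j'%:Z - k%:Z) - 1)) mN).
    apply: eq_bigr => k _; apply: eq_bigr => j' _.
    by rewrite (_ : j%:Z - i%:Z - (j'%:Z - k%:Z) = j%:Z - j'%:Z + (k%:Z - i%:Z)) //; ring.
  rewrite exchange_big /=; apply: eq_bigr => k _; rewrite sum_rectangle.
  congr (_ - _ - _); last by congr f; ring.
  by congr f; ring.
rewrite dbl.
have sum_rows (F G : 'I_N -> int) : (forall i, F i = G i) -> \sum_i F i = \sum_i G i.
  by move=> FG; apply: eq_bigr.
have rl := sum_rows _ _ (fun i : 'I_N => sum_row_hooks f la i pmu mN).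
have rm := sum_rows _ _ (fun i : 'I_N => sum_row_hooks (fun x => f (- x)) mu i pla lN).
rewrite !big_split /= in rl rm.
set A := \sum_(i < N) _ in rl *; set B := \sum_(i < N) _ in rm *.
set C := \sum_(i < N) \sum_(j < _) f (_ - _) in rl *.
set D := \sum_(i < N) \sum_(j < _) f (- (_ - _)) in rm *.
under [X in _ = _ - X]eq_bigr => i _ do rewrite !(big_split, sumrN) /=.
rewrite !(big_split, sumrN) /=.
set S1 := \sum_(i < N) \sum_(k < N) _ in rl.
set S2 := \sum_(i < N) \sum_(k < N) _ in rl.
set S3 := \sum_(i < N) \sum_(k < N) _ in rm.
set S4 := \sum_(i < N) \sum_(k < N) _ in rm.
have -> : \sum_(i < N) \sum_(k < N) f (- ((m k)%:Z + i%:Z - k%:Z)) = S4.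
  by rewrite exchange_big.
rewrite -[X in _ - (_ - X - _)]/S2 -!addrA.
have S13 : S1 + S3 = \sum_(i < N) \sum_(k < N) f (k%:Z - i%:Z) +
    \sum_(i < N) \sum_(k < N) f ((l i)%:Z - (m k)%:Z + (k%:Z - i%:Z)).
  rewrite /S3 exchange_big -!big_split /=; apply: eq_bigr => i _.
  rewrite -!big_split /=; apply: eq_bigr => k _; rewrite -/(l i) -/(m k).
  case: (leqP (m k) (l i)) => h.
    by rewrite addrC; congr (f _ + f _); lia.
  by congr (f _ + f _); lia.
rewrite (canRL (addrK _) rl) (canRL (addrK _) rm).
transitivity (C + D + S2 + S4 - (S1 + S3)); first by ring.
by rewrite S13; ring.
Qed.

End HookIdentity.

(** * The number of vanishing factors *)

Section Weight.
Variables (F : fieldType) (q : F) (Q : nat -> F) (l : nat).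
Hypothesis q0 : q != 0.

Definition residues (nu : seq (seq nat)) : seq F :=
  [seq content q Q x | x <- nodes nu].

(** The pairs with a = b account for the q-integers in the Schur element of nu,
    the other ones for the factors which involve two components. *)
Definition hook_weight (nu : seq (seq nat)) : int :=
  \sum_(a < l) \sum_(b < l) \sum_(x <- part_nodes (part nu a))
    (q ^ hook (part nu a) (part nu b) x.1 x.2 * Q a == Q b)%:Z.

(** Twice the weight of Fayers, as a function of the residues. *)
Definition residue_weight (s : seq F) : int :=
  (\sum_(x <- s) \sum_(b < l) (x == Q b)%:Z) *+ 2 -
  \sum_(x <- s) \sum_(y <- s)
     ((x == y)%:Z *+ 2 - (q * x == y)%:Z - (x == q * y)%:Z).

Lemma residue_weight_perm s s' : perm_eq s s' -> residue_weight s = residue_weight s'.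
Proof.
move=> ss'; rewrite /residue_weight (perm_big _ ss') /= (perm_big _ ss') /=.
by congr (_ - _); apply: eq_bigr => x _; apply: perm_big.
Qed.

Lemma big_nodes (V : zmodType) (nu : seq (seq nat)) (G : node -> V) :
  size nu = l ->
  \sum_(x <- nodes nu) G x = \sum_(a < l) \sum_(x <- part_nodes (part nu a)) G (nat_of_ord a, x).
Proof.
move=> <-; rewrite /nodes big_allpairs_dep /=.
have iotaE m : iota 0 m = index_iota 0 m by rewrite /index_iota subn0.
by rewrite iotaE big_mkord.
Qed.

(** The condition q^h Q_a = Q_b is q^(-h) Q_b = Q_a, so that each solution can be
    counted once at (a, b) with h and once at (b, a) with - h.  This is the form
    in which hook lengths appear in [hook_content_sums]. *)
Lemma hook_weight_residues nu : size nu = l -> all is_partition nu ->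
  hook_weight nu *+ 2 = residue_weight (residues nu).
Proof.
move=> snu pnu.
have pn (a : 'I_l) : is_partition (part nu a).
  by apply: (allP pnu); apply: mem_nth; rewrite snu.
pose f (a b : 'I_l) (k : int) := (q ^ k * Q a == Q b)%:Z.
have qz k : q ^ k != 0 by apply: expfz_neq0.
have -> : hook_weight nu *+ 2 = \sum_(a < l) \sum_(b < l)
   (\sum_(x <- part_nodes (part nu a)) f a b (hook (part nu a) (part nu b) x.1 x.2) +
    \sum_(x <- part_nodes (part nu b)) f a b (- hook (part nu b) (part nu a) x.1 x.2)).
  rewrite mulr2n {2}/hook_weight exchange_big -big_split /=; apply: eq_bigr => a _.
  rewrite -big_split /=; apply: eq_bigr => b _; congr (_ + _).
  apply: eq_bigr => x _; rewrite /f; congr (nat_of_bool _)%:Z.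
  set h := hook _ _ _ _; apply/eqP/eqP => [<-|<-].
    by rewrite mulrA -expfzDr // addNr expr0z mul1r.
  by rewrite mulrA -expfzDr // addrN expr0z mul1r.
under eq_bigr => a _ do under eq_bigr => b _ do
  rewrite (hook_content_sums (f a b) (pn a) (pn b)).
rewrite /residue_weight /residues !big_map !big_nodes //.
pose res (a : 'I_l) x := content q Q (nat_of_ord a, x).
have f0 a b x : f a b (ncontent x) = (res a x == Q b)%:Z by [].
have f1 a b y : f a b (- ncontent y) = (res b y == Q a)%:Z.
  rewrite /f /res /content /= -/(ncontent y); congr (nat_of_bool _)%:Z; set h := ncontent y.
  apply/eqP/eqP => [<-|<-]; rewrite mulrA -expfzDr //.
    by rewrite addrN expr0z mul1r.
  by rewrite addNr expr0z mul1r.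
have f2 a b x y c : f a b (ncontent x - ncontent y + c) = (q ^ c * res a x == res b y)%:Z.
  rewrite /f /res /content /= -/(ncontent y) -/(ncontent x); congr (nat_of_bool _)%:Z.
  rewrite -(inj_eq (mulfI (qz (ncontent y)))) !mulrA -!expfzDr //.
  by congr (q ^ _ * _ == _); ring.
rewrite mulr2n -big_split /=.
under eq_bigr => a _ do rewrite !(big_split, sumrN) /=.
rewrite !(big_split, sumrN) /=; congr (_ + _ - _).
- by apply: eq_bigr => a _; rewrite exchange_big.
- rewrite exchange_big; apply: eq_bigr => a _; rewrite exchange_big /=.
  by apply: eq_bigr => x _; apply: eq_bigr => b _; apply: f1.
- apply: eq_bigr => a _; rewrite exchange_big /=; apply: eq_bigr => x _.
  rewrite big_map big_nodes //; apply: eq_bigr => b _; apply: eq_bigr => y _.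
  rewrite -[_ - _ in X in X *+ 2]addr0 !f2 expr0z mul1r expr1z.
  congr (_ - _); congr (nat_of_bool _)%:Z; rewrite -/(res a x) -/(res b y).
  by rewrite -(inj_eq (mulfI q0)) mulrA exprN1 divff // mul1r.
Qed.
End Weight.

(** * Specialisation at a prime *)

Section SpecialisesTheory.
Variables (A : idomainType) (k : fieldType) (f : {rmorphism A -> k}).
Local Notation spec := (specialises f).

Let nz (b : A) : f b != 0 -> tofrac b != 0.
Proof. by rewrite tofrac_eq0; apply: contra_neq => ->; rewrite rmorph0. Qed.

Lemma specialises_tofrac a : spec (tofrac a) (f a).
Proof. by exists a, 1; rewrite !rmorph1 !divr1 oner_neq0. Qed.

Lemma specialises0 : spec 0 0.
Proof. by have := specialises_tofrac 0; rewrite !rmorph0. Qed.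

Lemma specialises1 : spec 1 1.
Proof. by have := specialises_tofrac 1; rewrite !rmorph1. Qed.

Lemma specialisesD x y z w : spec x z -> spec y w -> spec (x + y) (z + w).
Proof.
move=> [a [b [nb -> ->]]] [c [e [ne -> ->]]].
exists (a * e + c * b), (b * e); split; first by rewrite rmorphM mulf_neq0.
  by rewrite addf_div ?nz // !(rmorphD, rmorphM).
by rewrite addf_div // !(rmorphD, rmorphM).
Qed.

Lemma specialisesM x y z w : spec x z -> spec y w -> spec (x * y) (z * w).
Proof.
move=> [a [b [nb -> ->]]] [c [e [ne -> ->]]].
exists (a * c), (b * e); split; first by rewrite rmorphM mulf_neq0.
  by rewrite mulf_div !rmorphM.
by rewrite mulf_div !rmorphM.
Qed.

Lemma specialisesN x z : spec x z -> spec (- x) (- z).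
Proof.
move=> [a [b [nb -> ->]]]; exists (- a), b.
by split=> //; rewrite rmorphN mulNr.
Qed.

Lemma specialisesB x y z w : spec x z -> spec y w -> spec (x - y) (z - w).
Proof. by move=> xz yw; apply: specialisesD => //; apply: specialisesN. Qed.

Lemma specialisesV x z : z != 0 -> spec x z -> spec x^-1 z^-1.
Proof.
move=> z0 [a [b [nb xE zE]]]; exists b, a; split; last 2 first.
- by rewrite xE invf_div.
- by rewrite zE invf_div.
by apply: contra_neq z0; rewrite zE => ->; rewrite mul0r.
Qed.

Lemma specialises_sum (I : Type) (r : seq I) (P : pred I) F G :
  (forall i, P i -> spec (F i) (G i)) -> spec (\sum_(i <- r | P i) F i) (\sum_(i <- r | P i) G i).
Proof.
move=> FG; elim/big_ind2: _ => //; [exact: specialises0 | move=> ? ? ? ?; exact: specialisesD].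
Qed.

Lemma specialises_prod (I : Type) (r : seq I) (P : pred I) F G :
  (forall i, P i -> spec (F i) (G i)) -> spec (\prod_(i <- r | P i) F i) (\prod_(i <- r | P i) G i).
Proof.
move=> FG; elim/big_ind2: _ => //; [exact: specialises1 | move=> ? ? ? ?; exact: specialisesM].
Qed.

Lemma specialisesXn x z m : spec x z -> spec (x ^+ m) (z ^+ m).
Proof.
move=> xz; elim: m => [|m IH]; first by rewrite !expr0; apply: specialises1.
by rewrite !exprS; apply: specialisesM.
Qed.

Lemma specialisesXz x z (m : int) : z != 0 -> spec x z -> spec (x ^ m) (z ^ m).
Proof.
move=> z0 xz; case: m => m; first by rewrite -!exprnP; apply: specialisesXn.
rewrite NegzE -!exprnN; apply: specialisesV; last exact: specialisesXn.
by rewrite expf_neq0.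
Qed.

Lemma specialises_nat m : spec m%:R m%:R.
Proof. by have := specialises_tofrac m%:R; rewrite !rmorph_nat. Qed.

Lemma specialises_inj x z w : spec x z -> spec x w -> z = w.
Proof.
move=> [a [b [nb -> ->]]] [c [e [ne /eqP xE ->]]].
move: xE; rewrite eqr_div ?nz // -!rmorphM tofrac_eq => /eqP E.
by apply/eqP; rewrite eqr_div // -!rmorphM E.
Qed.

Lemma specialiseE x z : spec x z -> specialise f x = z.
Proof.
by move=> xz; apply: xget_unique => // w xw; apply: specialises_inj xw xz.
Qed.

Definition specialises_mx m n (X : 'M[{fraction A}]_(m, n)) (Y : 'M[k]_(m, n)) : Prop :=
  forall i j, spec (X i j) (Y i j).

Lemma specialises_mxD m n (X X' : 'M_(m, n)) Y Y' :
  specialises_mx X Y -> specialises_mx X' Y' -> specialises_mx (X + X') (Y + Y').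
Proof. by move=> h h' i j; rewrite !mxE; apply: specialisesD. Qed.

Lemma specialises_mxM m n p (X : 'M_(m, n)) (X' : 'M_(n, p)) Y Y' :
  specialises_mx X Y -> specialises_mx X' Y' -> specialises_mx (X *m X') (Y *m Y').
Proof.
move=> h h' i j; rewrite !mxE; apply: specialises_sum => c _; exact: specialisesM.
Qed.

Lemma specialises_mxZ m n a b (X : 'M_(m, n)) Y :
  spec a b -> specialises_mx X Y -> specialises_mx (a *: X) (b *: Y).
Proof. by move=> h h' i j; rewrite !mxE; apply: specialisesM. Qed.

Lemma specialises_mx1 n : specialises_mx (1%:M : 'M_n) 1%:M.
Proof. by move=> i j; rewrite !mxE; apply: specialises_nat. Qed.

End SpecialisesTheory.

(** * Valuations *)

Lemma natr_fieldExt_eq0 (K : fieldExtType rat) m : (m%:R == 0 :> K) = (m == 0%N).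
Proof. by rewrite -(rmorph_nat (in_alg K)) fmorph_eq0 pnatr_eq0. Qed.

Section Valuation.
Variables (K : fieldExtType rat) (L : fieldType) (th : {rmorphism {poly K} -> L}).
Variables (Phi : {poly K}).
Hypothesis Phi_neq0 : Phi != 0.
Hypothesis thE : forall p, (Phi %| p) = (th p == 0).
Hypothesis thX : th 'X != 0.
Local Notation spec := (specialises th).
Local Notation X := (tofrac 'X : Ky K).

(** The graph of the valuation, whose value is defined by choice in it. *)
Definition has_valuation (x : Ky K) (k : int) : Prop :=
  exists a b : {poly K}, [/\ ~~ (Phi %| a), ~~ (Phi %| b)
      & x = (tofrac Phi) ^ k * tofrac a / tofrac b].

Let nz0 p : ~~ (Phi %| p) -> tofrac p != 0.
Proof. by rewrite tofrac_eq0; apply: contraNneq => ->; apply: dvdp0. Qed.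

Let ndvdM p p' : ~~ (Phi %| p) -> ~~ (Phi %| p') -> ~~ (Phi %| p * p').
Proof. by rewrite !thE rmorphM mulf_eq0 negb_or => -> ->. Qed.

Let PhiF0 : tofrac Phi != 0 :> Ky K.
Proof. by rewrite tofrac_eq0. Qed.

Lemma has_valuation_le x j k : has_valuation x j -> has_valuation x k -> (j <= k)%R.
Proof.
move=> [a [b [na nb ->]]] [c [e [nc ne]]]; rewrite leNgt => E; apply/negP => kj.
have [m jE] : exists m : nat, j = k + m.+1%:Z by exists (absz (j - k - 1)%R); lia.
move: E; rewrite jE expfzDr // -!mulrA => /(mulfI (expfz_neq0 k PhiF0)) /eqP.
rewrite -exprnP -rmorphXn !mulrA -rmorphM eqr_div ?nz0 // -!rmorphM tofrac_eq => /eqP E.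
by have /negP := ndvdM nc nb; rewrite -E exprS -!mulrA dvdp_mulIl.
Qed.

Lemma valuationE x k : has_valuation x k -> valuation Phi x = k.
Proof.
move=> xk; apply: xget_unique => // j xj.
by apply/le_anti; rewrite !(has_valuation_le xj xk, has_valuation_le xk xj).
Qed.

Lemma has_valuationM x y j k :
  has_valuation x j -> has_valuation y k -> has_valuation (x * y) (j + k).
Proof.
move=> [a [b [na nb ->]]] [c [e [nc ne ->]]]; exists (a * c), (b * e).
split; [exact: ndvdM | exact: ndvdM | rewrite expfzDr // !rmorphM /=].
by rewrite mulf_div; congr (_ / _); ring.
Qed.

Lemma has_valuation_prod (I : Type) (r : seq I) (P : pred I) F G :
  (forall i, P i -> has_valuation (F i) (G i)) ->
  has_valuation (\prod_(i <- r | P i) F i) (\sum_(i <- r | P i) G i).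
Proof.
move=> FG; elim/big_ind2: _ => //; last by move=> ? ? ? ?; apply: has_valuationM.
by exists 1, 1; rewrite !thE rmorph1 oner_eq0 expr0z !rmorph1 divr1 mulr1.
Qed.

Lemma has_valuation_unit x z : z != 0 -> spec x z -> has_valuation x 0.
Proof.
move=> z0 [a [b [nb -> zE]]]; exists a, b; rewrite !thE nb expr0z mul1r; split=> //.
by apply: contra_neq z0; rewrite zE => ->; rewrite mul0r.
Qed.

Lemma spec_X : spec X (th 'X). Proof. exact: specialises_tofrac. Qed.

Lemma thC_eq0 c : (th c%:P == 0) = (c == 0).
Proof. exact: (fmorph_eq0 (th \o polyC)). Qed.

(** For N != 0 the binomial has no multiple root, in characteristic 0; for N = 0
    it is a nonzero constant. *)
Lemma has_valuation_binomial (c : K) (N : int) : c != 0 -> (N != 0) || (c != 1) ->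
  has_valuation (X ^ N * tofrac c%:P - 1) (th 'X ^ N * th c%:P == 1)%:Z.
Proof.
have pos (e : K) (m : nat) : e != 0 ->
  has_valuation (X ^ m.+1%:Z * tofrac e%:P - 1) (th 'X ^ m.+1%:Z * th e%:P == 1)%:Z.
  move=> e0; have -> : X ^ m.+1%:Z * tofrac e%:P - 1 = tofrac ('X^(m.+1) * e%:P - 1).
    by rewrite rmorphB rmorphM rmorphXn rmorph1 exprnP.
  have thv : th ('X^(m.+1) * e%:P - 1) = th 'X ^ m.+1%:Z * th e%:P - 1.
    by rewrite rmorphB rmorphM rmorphXn rmorph1 exprnP.
  case: eqP => [th1|/eqP th1]; last first.
    apply: (@has_valuation_unit _ (th ('X^(m.+1) * e%:P - 1))); last exact: specialises_tofrac.
    by rewrite thv subr_eq0.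
  have /dvdpP[u uE] : Phi %| 'X^(m.+1) * e%:P - 1 by rewrite thE thv th1 subrr.
  exists u, 1; split; last 2 first.
  - by rewrite thE rmorph1 oner_eq0.
  - by rewrite uE rmorphM rmorph1 divr1 mulrC.
  (* Otherwise the square of Phi divides a separable polynomial. *)
  apply/negP => /dvdpP[v vE].
  have : Phi %| ('X^(m.+1) * e%:P - 1)^`().
    by rewrite uE vE derivM dvdp_add ?dvdp_mulIr // dvdp_mulr // dvdp_mulIr.
  rewrite derivB derivM derivC mulr0 addr0 derivXn -polyC1 derivC subr0 /= thE.
  rewrite -mulr_natl -polyC_natr !rmorphM rmorphXn !mulf_eq0 expf_eq0 (negbTE thX) andbF.
  by rewrite !thC_eq0 (negbTE e0) natr_fieldExt_eq0.
case: N => [[|m]|m] c0 /= NE; [|exact: pos|].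
  rewrite !expr0z !mul1r.
  have -> : tofrac c%:P - 1 = tofrac (c - 1)%:P :> Ky K.
    by rewrite polyCB rmorphB polyC1 rmorph1.
  have -> : (th c%:P == 1) = false.
    apply/negbTE; rewrite -subr_eq0 -(rmorph1 th) -rmorphB -polyC1 -polyCB thC_eq0.
    by rewrite subr_eq0.
  apply: (@has_valuation_unit _ (th (c - 1)%:P)); last exact: specialises_tofrac.
  by rewrite thC_eq0 subr_eq0.
rewrite NegzE; set N : int := m.+1%:Z; pose e := c^-1.
have e0 : e != 0 by rewrite invr_eq0.
have X0 : X != 0 by rewrite tofrac_eq0 polyX_eq0.
have eK : tofrac c%:P * tofrac e%:P = 1 :> Ky K.
  by rewrite -rmorphM -polyCM /e divff // !rmorph1.
have teK : th c%:P * th e%:P = 1 by rewrite -rmorphM -polyCM /e divff // rmorph1.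
have -> : X ^ (- N) * tofrac c%:P - 1 =
    (X ^ (- N) * (- tofrac c%:P)) * (X ^ N * tofrac e%:P - 1).
  rewrite mulrBr mulr1 mulrACA -expfzDr // addNr expr0z mulNr eK mul1r mulrN opprK.
  by rewrite addrC.
have -> : (th 'X ^ (- N) * th c%:P == 1) = (th 'X ^ N * th e%:P == 1).
  rewrite -(inj_eq (mulfI (expfz_neq0 N thX))) mulrA -expfzDr // addrN expr0z mul1r mulr1.
  rewrite -(inj_eq (mulIf (_ : th e%:P != 0))) ?thC_eq0 // teK eq_sym.
  by [].
rewrite -[X in has_valuation _ X]add0r; apply: has_valuationM; last exact: pos.
apply: (@has_valuation_unit _ (th 'X ^ (- N) * (- th c%:P))).
  by rewrite mulf_neq0 ?expfz_neq0 // oppr_eq0 thC_eq0.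
apply: specialisesM; first exact: specialisesXz spec_X.
by apply: specialisesN; apply: specialises_tofrac.
Qed.

End Valuation.

Lemma primitive_root_neq0 (F : fieldType) m (z : F) : m.-primitive_root z -> z != 0.
Proof. by move=> zm; rewrite (prim_root_eq0 zm) -lt0n (prim_order_gt0 zm). Qed.

Section SchurValuation.
Variables (K : fieldExtType rat) (L : fieldType) (th : {rmorphism {poly K} -> L}).
Variables (Phi : {poly K}).
Hypothesis Phi_neq0 : Phi != 0.
Hypothesis thE : forall p, (Phi %| p) = (th p == 0).
Hypothesis thX : th 'X != 0.
Variables (l : nat) (z : K) (rr : nat -> int) (r : int).
Hypothesis z_prim : l.-primitive_root z.
Local Notation spec := (specialises th).
Local Notation X := (tofrac 'X : Ky K).
Local Notation has_val := (has_valuation Phi).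

(** The parameters over K(y), and their residues at Phi. *)
Definition cyclotomic_q : Ky K := X ^ r.
Definition cyclotomic_Q (a : nat) : Ky K := tofrac (z ^+ a)%:P * X ^ rr a.
Definition residual_q : L := th 'X ^ r.
Definition residual_Q (a : nat) : L := th (z ^+ a)%:P * th 'X ^ rr a.

Let X_neq0 : X != 0. Proof. by rewrite tofrac_eq0 polyX_eq0. Qed.
Let z_neq0 : z != 0 := primitive_root_neq0 z_prim.

Let spec_qK : spec cyclotomic_q residual_q.
Proof. by apply: specialisesXz => //; exact: spec_X. Qed.
Let qL_neq0 : residual_q != 0. Proof. exact: expfz_neq0. Qed.

Lemma hook_node_gt0 la i j : is_partition la -> (i, j) \in part_nodes la ->
  0 < hook la la i j.
Proof.
move=> pla /allpairsPdep[i'[j'[_ jj [-> ->]]]].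
move: jj; rewrite mem_iota add0n => /= jj.
have := conj_partP j' i' pla; rewrite jj => /esym ii.
by rewrite /hook; lia.
Qed.

(** Here q - 1 is a unit at Phi unless q specialises to 1, and in the latter case
    [k]_q specialises to k. *)
Lemma has_valuation_qint k : (0 < k)%N ->
  has_val (qint cyclotomic_q k) ((residual_q ^ k%:Z == 1)%:Z - (residual_q == 1)%:Z).
Proof.
move=> k0; case: (eqVneq residual_q 1) => [q1|q1].
  rewrite q1 exp1rz eqxx subrr.
  apply: (@has_valuation_unit _ _ th _ thE _ (k%:R)).
    by rewrite -(rmorph_nat (th \o polyC)) fmorph_eq0 natr_fieldExt_eq0 -lt0n.
  rewrite -[X in X%:R]card_ord -sumr_const; apply: specialises_sum => s _.
  by rewrite -(expr1n _ s) -q1; apply: specialisesXn.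
have r0 : r != 0 by apply: contra_neq q1 => r0; rewrite /residual_q r0 expr0z.
have q1K : has_val (cyclotomic_q - 1) 0.
  apply: (@has_valuation_unit _ _ th _ thE _ (residual_q - 1)); first by rewrite subr_eq0.
  by apply: specialisesB => //; apply: specialises1.
(* The binomial is (X^r)^k - 1, with exponent r k != 0. *)
have qkK : has_val (cyclotomic_q ^+ k - 1) (residual_q ^ k%:Z == 1)%:Z.
  have := @has_valuation_binomial _ _ th _ Phi_neq0 thE thX 1 (r * k%:Z).
  rewrite oner_eq0 polyC1 !rmorph1 !mulr1 -!exprz_exp -!exprnP; apply=> //.
  by rewrite mulf_neq0 // -lt0n.
have [a [b [na nb q1E]]] := q1K; rewrite subr0 /=.
have q1V : has_val (cyclotomic_q - 1)^-1 0.
  exists b, a; split=> //; rewrite q1E expr0z !mul1r.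
  by rewrite invf_div.
have q1n : cyclotomic_q - 1 != 0.
  rewrite q1E expr0z mul1r mulf_neq0 ?invr_eq0 ?tofrac_eq0 //.
    by apply: contraNneq na => ->; apply: dvdp0.
  by apply: contraNneq nb => ->; apply: dvdp0.
have -> : qint cyclotomic_q k = (cyclotomic_q ^+ k - 1) * (cyclotomic_q - 1)^-1.
  by rewrite subrX1 mulrC mulKf.
by rewrite -[X in has_valuation _ _ X]addr0; apply: has_valuationM thE _ _ _ _ qkK q1V.
Qed.

(** The constant z^(a - b) is not 1, which excludes that the factor is 0. *)
Lemma has_valuation_ak_factor (a b : 'I_l) (h : int) : b != a ->
  has_val (cyclotomic_q ^ h * cyclotomic_Q a * (cyclotomic_Q b)^-1 - 1)
    (residual_q ^ h * residual_Q a == residual_Q b)%:Z.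
Proof.
move=> ba.
pose c := z ^+ a / z ^+ b; pose N := r * h + rr a - rr b.
have c0 : c != 0 by rewrite mulf_neq0 ?invr_eq0 ?expf_neq0.
have c1 : c != 1.
  apply: contra ba => /eqP cE; have : z ^+ a = z ^+ b.
    by rewrite -[LHS](mulfVK (expf_neq0 b z_neq0)) -/c cE mul1r.
  by move/eqP; rewrite (eq_prim_root_expr z_prim) !modn_small // => /eqP /val_inj ->.
have cE : tofrac c%:P = tofrac (z ^+ a)%:P / tofrac (z ^+ b)%:P :> Ky K.
  rewrite /c polyCM rmorphM; congr (_ * _).
  exact: (fmorphV (@tofrac {poly K} \o polyC)).
have tcE : th c%:P = th (z ^+ a)%:P / th (z ^+ b)%:P.
  rewrite /c polyCM rmorphM; congr (_ * _).
  exact: (fmorphV (th \o polyC)).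
have -> : cyclotomic_q ^ h * cyclotomic_Q a * (cyclotomic_Q b)^-1 = X ^ N * tofrac c%:P.
  rewrite cE /cyclotomic_Q /N /cyclotomic_q exprz_exp !expfzDr // invfM -invr_expz.
  by ring.
have -> : (residual_q ^ h * residual_Q a == residual_Q b) = (th 'X ^ N * th c%:P == 1).
  have QLb : residual_Q b != 0 by rewrite mulf_neq0 ?thC_eq0 ?expfz_neq0 ?expf_neq0.
  rewrite -(inj_eq (mulIf (_ : (residual_Q b)^-1 != 0))) ?invr_eq0 // divff //.
  rewrite tcE /residual_Q /N /residual_q exprz_exp !expfzDr // invfM -invr_expz; congr (_ == _).
  by ring.
by apply: has_valuation_binomial => //; rewrite c1 orbT.
Qed.

(** When q specialises to 1, hook_weight counts all the nodes at a = b, while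
    their q-integers are units; hence the correction. *)
Theorem has_valuation_ak_schur nu : size nu = l -> all is_partition nu ->
  has_val (ak_schur cyclotomic_q cyclotomic_Q l nu)
    (hook_weight residual_q residual_Q l nu - (residual_q == 1)%:Z * (size (nodes nu))%:Z).
Proof.
move=> snu pnu.
pose G (a : 'I_l) (x : nat * nat) : int :=
  (residual_q ^ hook (part nu a) (part nu a) x.1 x.2 == 1)%:Z - (residual_q == 1)%:Z +
  \sum_(b < l | b != a)
    (residual_q ^ hook (part nu a) (part nu b) x.1 x.2 * residual_Q a == residual_Q b)%:Z.
have -> : hook_weight residual_q residual_Q l nu - (residual_q == 1)%:Z * (size (nodes nu))%:Z =
   0 + \sum_(a < l) \sum_(x <- part_nodes (part nu a)) G a x.
  have -> : (size (nodes nu))%:Z = \sum_(x <- nodes nu) 1.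
    by rewrite big_const_seq count_predT iter_addr_0 natz.
  rewrite add0r (big_nodes (fun _ => 1) snu) mulr_sumr.
  rewrite /hook_weight -sumrB; apply: eq_bigr => a _.
  rewrite exchange_big /= mulr_sumr -sumrB; apply: eq_bigr => x _.
  rewrite (bigD1 a) //= mulr1 /G addrAC; congr (_ - _ + _); congr (nat_of_bool _)%:Z.
  have Qa : residual_Q a != 0 by rewrite mulf_neq0 ?thC_eq0 ?expfz_neq0 ?expf_neq0.
  by rewrite -{2}[residual_Q a]mul1r (inj_eq (mulIf Qa)).
apply: (has_valuationM Phi_neq0 thE).
  apply: (@has_valuation_unit _ _ th _ thE _
    ((-1) ^+ (msum nu * (l - 1)) * residual_q ^- Nstat (sort geq (flatten nu)))).
    by rewrite mulf_neq0 ?invr_eq0 ?expf_neq0 // oppr_eq0 oner_eq0.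
  apply: specialisesM.
    by apply: specialisesXn; apply: specialisesN; apply: specialises1.
  by apply: specialisesV; [rewrite expf_neq0 | apply: specialisesXn].
apply: (has_valuation_prod Phi_neq0 thE) => a _.
rewrite big_seq_cond [X in has_valuation _ _ X]big_seq_cond.
apply: (has_valuation_prod Phi_neq0 thE) => x; rewrite andbT => xa.
apply: (has_valuationM Phi_neq0 thE); last first.
  by apply: (has_valuation_prod Phi_neq0 thE) => b ba; apply: has_valuation_ak_factor.
have pa : is_partition (part nu a).
  by apply: (allP pnu); apply: mem_nth; rewrite snu.
have h0 : 0 < hook (part nu a) (part nu a) x.1 x.2.
  by apply: hook_node_gt0; rewrite -?surjective_pairing.
set h := hook _ _ _ _ in h0 *.
have hE : h = (absz h)%:Z by lia.
rewrite [in X in has_valuation _ _ X]hE; apply: has_valuation_qint; lia.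
Qed.

End SchurValuation.

(** * Jucys--Murphy elements and central elements *)

(** X, Y stand for X_k, X_(k+1), then g for g_k, E for (q - 1) e_k, and a, b for
    powers of t_k, t_(k+1); p is the inverse of q. *)
Section Exchange.
Local Notation comm := GRing.comm.
Variables (A : pzRingType) (q p g X Y E : A).
Hypothesis pq : p * q = 1.
Hypothesis pC : forall x, comm p x.
Hypothesis qC : forall x, comm q x.
Hypothesis gg : g * g = q + E * g.
Hypothesis YE : Y = p * (g * X * g).
Hypothesis XY : comm X Y.
Hypothesis Eg : comm E g.
Hypothesis EX : comm E X.

Lemma exchange_EY : comm E Y.
Proof.
rewrite YE; apply: commrM; first exact/commr_sym/pC.
by apply: commrM => //; apply: commrM.
Qed.

Lemma exchange_gY : g * Y = X * g + E * Y.
Proof.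
rewrite {1}YE mulrA -[g * p]pC -!mulrA [g * (g * _)]mulrA gg !mulrDl mulrDr.
rewrite [p * (q * _)]mulrA pq mul1r -[E * g * _]mulrA [p * (E * _)]mulrA pC -[E * p * _]mulrA.
by rewrite YE -!mulrA.
Qed.

Lemma exchange_Yg : Y * g = g * X + E * Y.
Proof.
rewrite {1}YE -!mulrA gg !mulrDr.
rewrite -[X * q]qC [g * (q * _)]mulrA -[g * q]qC -[q * g * _]mulrA [p * (q * _)]mulrA pq mul1r.
congr (_ + _).
rewrite [X * (E * g)]mulrA -EX -[E * X * g]mulrA [g * (E * _)]mulrA -Eg -[E * g * _]mulrA.
by rewrite [p * (E * _)]mulrA pC YE -!mulrA.
Qed.

Lemma exchange_gX : g * X = Y * g - E * Y.
Proof. by rewrite exchange_Yg addrK. Qed.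

(** The complete homogeneous symmetric polynomial of degree m - 1 in X, Y. *)
Fixpoint complete_sym (m : nat) : A :=
  if m is m'.+1 then complete_sym m' * X + Y ^+ m' else 0.

Lemma complete_symE m : complete_sym m * X + Y ^+ m = complete_sym m * Y + X ^+ m.
Proof.
elim: m => [|m IH] /=; first by rewrite !mul0r.
by rewrite {1}IH !mulrDl -!exprSr -!mulrA XY addrAC.
Qed.

Lemma complete_sym_comm x m : comm x X -> comm x Y -> comm x (complete_sym m).
Proof.
move=> xX xY; elim: m => [|m IH] /=; first exact: commr0.
by apply: commrD; [apply: commrM | apply: commrX].
Qed.

Lemma exchange_powers m :
  g * X ^+ m = Y ^+ m * g - E * Y * complete_sym m /\
  g * Y ^+ m = X ^+ m * g + E * Y * complete_sym m.
Proof.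
have EY := exchange_EY.
elim: m => [|m [gX gY]] /=; first by rewrite !mulr0 subr0 addr0 !mulr1 !mul1r.
split.
  rewrite exprSr mulrA gX mulrBl -mulrA exchange_gX mulrBr mulrA -exprSr.
  rewrite mulrDr opprD addrA [RHS]addrAC !mulrA; congr (_ - _ - _).
  by rewrite -(commrX m EY) -!mulrA -exprSr -exprS.
have EYX : comm (E * Y) (X ^+ m).
  by apply/commr_sym/commrM; apply/commr_sym/commrX => //; apply/commr_sym.
rewrite complete_symE exprSr mulrA gY mulrDl -mulrA exchange_gY mulrDr mulrA -exprSr.
by rewrite mulrDr -addrA EYX [X in _ + X]addrC !mulrA.
Qed.

(** The correction terms of the two summands are multiples of E, which does not
    distinguish a from b, so that they cancel. *)
Lemma exchange_symmetric a b m : g * a = b * g -> g * b = a * g -> E * a = E * b ->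
  comm g (X ^+ m * a + Y ^+ m * b).
Proof.
move=> ga gb Eab; have [] := exchange_powers m; set D := _ * complete_sym m => gX gY.
have EY := exchange_EY.
have Dab : D * a = D * b.
  have EC : comm E (Y * complete_sym m) by apply: commrM => //; apply: complete_sym_comm.
  by rewrite /D -(mulrA E) EC -!(mulrA _ E) Eab.
rewrite /GRing.comm mulrDr mulrDl !mulrA gX gY mulrBl mulrDl Dab -!mulrA ga gb.
by rewrite addrCA subrK.
Qed.

(** Unlike g, it exchanges X and Y without correction terms, and its square is a
    polynomial in X, Y and E. *)
Definition intertwiner : A := g * (X - Y) + E * Y.

Lemma intertwinerX : intertwiner * X = Y * intertwiner.
Proof.
have EY := exchange_EY; have gX := exchange_gX; rewrite /intertwiner.
have ZX : (X - Y) * X = X * (X - Y) by rewrite mulrBl mulrBr XY.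
have EYZ : E * Y * (X - Y) = E * Y * X - Y * (E * Y) by rewrite mulrBr [Y * (E * Y)]mulrA EY.
move: ZX EYZ; move: (X - Y) => Z ZX EYZ.
by rewrite mulrDl -mulrA ZX mulrA gX mulrBl EYZ opprB addrA subrK mulrDr !mulrA.
Qed.

Lemma intertwinerY : intertwiner * Y = X * intertwiner.
Proof.
have EY := exchange_EY; have gY := exchange_gY; rewrite /intertwiner.
have ZY : (X - Y) * Y = Y * (X - Y) by rewrite mulrBl mulrBr XY.
have EYZ : E * Y * (X - Y) = X * (E * Y) - E * Y * Y.
  by rewrite mulrBr -mulrA -XY !mulrA EX.
move: ZY EYZ; move: (X - Y) => Z ZY EYZ.
by rewrite mulrDl -mulrA ZY mulrA gY mulrDl EYZ -addrA subrK mulrDr !mulrA.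
Qed.

Lemma intertwiner_sqr :
  intertwiner * intertwiner = - (q * (X - Y) * (X - Y)) + E * E * Y * X.
Proof.
have EY := exchange_EY.
have tE : intertwiner = (Y - X) * g - E * Y.
  rewrite /intertwiner mulrBr exchange_gX exchange_gY mulrBl opprD addrA subrK.
  by rewrite addrAC.
have gt : g * intertwiner = q * (X - Y) + E * (g * X).
  rewrite /intertwiner mulrDr !mulrA gg mulrDl -addrA -[g * E]Eg -!mulrA -mulrDr -mulrDr.
  by rewrite subrK.
have qW : (Y - X) * (q * (X - Y)) = - (q * (X - Y) * (X - Y)).
  by rewrite mulrA -qC -[in LHS]opprB mulrN mulNr.
have EW : (Y - X) * E = E * (Y - X) by apply/esym/commrB.
have EYt : E * Y * intertwiner = E * (intertwiner * X) by rewrite intertwinerX mulrA.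
move: tE qW EW; move: (Y - X) => W tE qW EW.
rewrite {1}tE mulrBl -mulrA gt mulrDr qW EYt -addrA; congr (_ + _).
rewrite mulrA EW -!mulrA -mulrBr; congr (_ * _).
by rewrite tE mulrBl !mulrA opprB addrC subrK.
Qed.

Lemma intertwiner_swap y y' : g * y = y' * g -> E * y = y' * E ->
  comm X y -> comm Y y -> intertwiner * y = y' * intertwiner.
Proof.
move=> gy Ey Xy Yy; rewrite /intertwiner.
have Zy : (X - Y) * y = y * (X - Y) by apply/commr_sym/commrB; apply/commr_sym.
move: Zy; move: (X - Y) => Z Zy.
by rewrite mulrDl -!mulrA Zy Yy !mulrA gy Ey mulrDr !mulrA.
Qed.

End Exchange.

Section JucysMurphy.
Local Notation comm := GRing.comm.
Variables (A : pzRingType) (n : nat) (q p : A) (g t E : nat -> A).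

(** The relations of the cyclotomic Yokonuma--Hecke algebra which do not depend on
    d and l, with E k for (q - 1) e_k and g 0 for X_1; the dependence on d is
    hidden in the properties of e_k. *)
Record yh_relations : Prop := YhRelations {
  yh_pq : p * q = 1;
  yh_pC : forall x, comm p x;
  yh_qC : forall x, comm q x;
  yh_far : forall i j, (i.+1 < j)%N -> (j < n)%N -> comm (g i) (g j);
  yh_braid : forall i, (0 < i)%N -> (i.+1 < n)%N ->
    g i * g i.+1 * g i = g i.+1 * g i * g i.+1;
  yh_braid0 : (1 < n)%N -> g 0 * g 1 * g 0 * g 1 = g 1 * g 0 * g 1 * g 0;
  yh_tt : forall i j, (i < n)%N -> (j < n)%N -> comm (t i) (t j);
  yh_g0t : forall j, (j < n)%N -> comm (g 0) (t j);
  yh_gt : forall i j, (i.+1 < n)%N -> (j < n)%N -> j != i -> j != i.+1 ->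
    comm (g i.+1) (t j);
  yh_gtl : forall i, (i.+1 < n)%N -> g i.+1 * t i = t i.+1 * g i.+1;
  yh_gtr : forall i, (i.+1 < n)%N -> g i.+1 * t i.+1 = t i * g i.+1;
  yh_gg : forall i, (i.+1 < n)%N -> g i.+1 * g i.+1 = q + E i.+1 * g i.+1;
  yh_EC : forall i x, (i.+1 < n)%N -> comm x (t i) -> comm x (t i.+1) -> comm x (E i.+1);
  yh_Eg : forall i, (i.+1 < n)%N -> comm (E i.+1) (g i.+1);
  yh_Et : forall i, (i.+1 < n)%N -> E i.+1 * t i = E i.+1 * t i.+1 }.

Hypothesis rel : yh_relations.

Fixpoint jm (k : nat) : A :=
  if k is k'.+1 then p * (g k'.+1 * jm k' * g k'.+1) else g 0.

Let commM3 x a b c : comm x a -> comm x b -> comm x c -> comm x (p * (a * b * c)).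
Proof.
move=> xa xb xc; apply: commrM; first exact/commr_sym/(yh_pC rel).
by apply: commrM => //; apply: commrM.
Qed.

Lemma jm_g_far k j : (k.+1 < j)%N -> (j < n)%N -> comm (g j) (jm k).
Proof.
elim: k => [|k IH] kj jn; first exact/commr_sym/(yh_far rel).
have gk : comm (g j) (g k.+1) by apply/commr_sym/(yh_far rel).
by apply: commM3 => //; apply: IH => //; apply: ltnW.
Qed.

Lemma jm_t k j : (k < n)%N -> (j < n)%N -> comm (jm k) (t j).
Proof.
elim: k j => [|k IH] j kn jn; first exact: yh_g0t.
have kn' : (k < n)%N by apply: ltnW.
have sandwich a x y y' : a * y = y' * a -> a * y' = y * a -> comm x y' ->
    comm (p * (a * x * a)) y.
  move=> ay ay' xy'; rewrite /GRing.comm [RHS]mulrA -(yh_pC rel) -!mulrA; congr (p * _).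
  by rewrite ay !mulrA -(mulrA a) xy' mulrA ay'.
case: (eqVneq j k) => [->|jk].
  by apply: sandwich (yh_gtl rel kn) (yh_gtr rel kn) _; apply: IH.
case: (eqVneq j k.+1) => [->|jk1].
  by apply: sandwich (yh_gtr rel kn) (yh_gtl rel kn) _; apply: IH.
by apply: sandwich (yh_gt rel _ _ _ _) (yh_gt rel _ _ _ _) _ => //; apply: IH.
Qed.

(** For j = k - 1, the braid relation changes g_j, coming from the left, into g_k
    in front of jm (k - 2), with which g_k commutes, and then back into g_j. *)
Lemma jm_g_below k j : (0 < j)%N -> (j < k)%N -> (k < n)%N -> comm (g j) (jm k).
Proof.
move=> j0; elim: k => // k IH; rewrite ltnS leq_eqVlt => /orP[/eqP jk|jk] kn.
  case: k jk kn {IH} => [|k] jk kn; first by rewrite jk in j0.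
  rewrite jk /= /GRing.comm; set a := g k.+1; set b := g k.+2; set x := jm k.
  have bx : b * x = x * b by apply: jm_g_far.
  have aba : a * b * a = b * a * b by apply: yh_braid.
  have pC := yh_pC rel.
  have pull u v : u * (p * v) = p * (u * v) by rewrite mulrA -pC mulrA.
  rewrite -!mulrA !pull; do 2!congr (p * _); rewrite !mulrA aba -(mulrA (b * a)) bx.
  by rewrite -!mulrA (mulrA b a b) -aba !mulrA.
have gk : comm (g j) (g k.+1) by apply: (yh_far rel).
by apply: commM3 => //; apply: IH => //; apply: ltnW.
Qed.

Lemma jm_g0 k : (k < n)%N -> comm (g 0) (jm k).
Proof.
elim: k => [//|[|k] IH] kn.
  have pC := yh_pC rel.
  rewrite /= /GRing.comm mulrA -pC -!mulrA; congr (p * _).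
  by rewrite !mulrA (yh_braid0 rel).
have gk : comm (g 0) (g k.+2) by apply: (yh_far rel).
by apply: commM3 => //; apply: IH; apply: ltnW.
Qed.

Lemma jm_comm i j : (i < n)%N -> (j < n)%N -> comm (jm i) (jm j).
Proof.
wlog ij : i j / (i <= j)%N => [wl|] ii jj.
  by case: (leqP i j) => [|/ltnW] ij; [|apply: commr_sym]; apply: wl.
move: ij; rewrite leq_eqVlt => /orP[/eqP -> //|ij].
elim: i ii ij => [|i IH] ii ij; first exact: jm_g0.
apply: commr_sym; have gj : comm (jm j) (g i.+1) by apply/commr_sym/jm_g_below.
by apply: commM3 => //; apply/commr_sym/IH; apply: ltnW.
Qed.

Section Neighbours.
Variable k : nat.
Hypothesis kn : (k.+1 < n)%N.
Let kn' : (k < n)%N := ltnW kn.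

Lemma jm_E i : (i < n)%N -> comm (E k.+1) (jm i).
Proof. by move=> ii; apply/commr_sym/(yh_EC rel); rewrite //; apply: jm_t. Qed.

Lemma t_E i : (i < n)%N -> comm (E k.+1) (t i).
Proof. by move=> ii; apply/commr_sym/(yh_EC rel); rewrite //; apply: (yh_tt rel). Qed.

Definition jm_intertwiner := intertwiner (g k.+1) (jm k) (jm k.+1) (E k.+1).

Let XY := jm_comm kn' kn.
Let EX := jm_E kn'.
Let EY := jm_E kn.

Lemma jm_intertwinerY : jm_intertwiner * jm k.+1 = jm k * jm_intertwiner.
Proof. by apply: (@intertwinerY _ q p) => //; case: rel => // *; auto. Qed.

Lemma jm_intertwiner_sqr : jm_intertwiner * jm_intertwiner =
  - (q * (jm k - jm k.+1) * (jm k - jm k.+1)) + E k.+1 * E k.+1 * jm k.+1 * jm k.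
Proof. by apply: (@intertwiner_sqr _ q p) => //; case: rel => // *; auto. Qed.

Lemma jm_intertwiner_jm i : (i < k)%N -> comm jm_intertwiner (jm i).
Proof.
move=> ik; have ii := ltn_trans ik kn'.
have c j : (j < n)%N -> comm (jm i) (jm j) by apply: jm_comm.
apply: commr_sym; apply: commrD; apply: commrM.
- exact/commr_sym/jm_g_far.
- by apply: commrB; apply: c.
- exact/commr_sym/jm_E.
- exact: c.
Qed.

Lemma t_jm_intertwiner i : (i < n)%N ->
  exists2 j, (j < n)%N & t i * jm_intertwiner = jm_intertwiner * t j.
Proof.
move=> ii; have Et := yh_Et rel kn.
case: (eqVneq i k) => [->|ik].
  exists k.+1 => //; apply/esym/intertwiner_swap; rewrite ?(yh_gtr rel) -?Et ?t_E //; exact: jm_t.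
case: (eqVneq i k.+1) => [->|ik1].
  exists k => //; apply/esym/intertwiner_swap; rewrite ?(yh_gtl rel) ?Et ?t_E //; exact: jm_t.
by exists i => //; apply/esym/intertwiner_swap; rewrite ?(yh_gt rel) ?t_E //; exact: jm_t.
Qed.

End Neighbours.

(** The t_k are recorded along with the X_k in order to tell the factors
    lambda[1], ..., lambda[d] of the label lambda from each other. *)
Definition color_power_sum (m s : nat) : A := \sum_(k < n) jm k ^+ m * t k ^+ s.

Lemma color_power_sum_t m s j : (j < n)%N -> comm (t j) (color_power_sum m s).
Proof.
move=> jn; apply: commr_sum => k _; apply: commrM; apply: commrX.
  exact/commr_sym/jm_t.
exact: (yh_tt rel).
Qed.

Let swapX (x y y' : A) s : x * y = y' * x -> x * y ^+ s = y' ^+ s * x.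
Proof.
move=> xy; elim: s => [|s IH]; first by rewrite mulr1 mul1r.
by rewrite exprS mulrA xy -mulrA IH mulrA -exprS.
Qed.

Lemma color_power_sum_g m s i : (i < n)%N -> comm (g i) (color_power_sum m s).
Proof.
case: i => [|i] ii.
  apply: commr_sum => k _; apply: commrM; apply: commrX; first exact: jm_g0.
  exact: (yh_g0t rel).
have ii' : (i < n)%N := ltnW ii.
rewrite /color_power_sum (bigD1 (Ordinal ii')) //= (bigD1 (Ordinal ii)) /=; last first.
  by rewrite -val_eqE /= eqn_leq ltnn.
rewrite addrA; apply: commrD.
  have Es : E i.+1 * t i ^+ s = E i.+1 * t i.+1 ^+ s.
    elim: s => // s IH; rewrite !exprS !mulrA (yh_Et rel) // [E _ * _](t_E ii ii) -!mulrA.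
    by rewrite IH.
  apply: (@exchange_symmetric _ q p _ (jm i) (jm i.+1) (E i.+1)) => //; try by case: rel => *; auto.
  - exact: jm_comm.
  - exact: jm_E.
apply: commr_sum => k; rewrite -!val_eqE /= => /andP[ki ki1].
apply: commrM; apply: commrX; last exact: (yh_gt rel).
case: (ltngtP k i) => [ki'|ik|/eqP]; last by rewrite (negbTE ki).
  exact: jm_g_far.
by apply: jm_g_below => //; rewrite ltn_neqAle eq_sym ki1.
Qed.

End JucysMurphy.

Section Average.
Local Notation comm := GRing.comm.
Variables (A : pzRingType) (d : nat) (a b : A).
Hypotheses (ad : a ^+ d = 1) (bd : b ^+ d = 1) (ab : comm a b).

(** This is d e_k when a and b are t_k and t_(k+1), as b^(d-s) is then b^(-s). *)
Definition cyclic_sum : A := \sum_(s < d) a ^+ s * b ^+ (d - s).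

Lemma cyclic_sum_comm x : comm x a -> comm x b -> comm x cyclic_sum.
Proof. by move=> xa xb; apply: commr_sum => s _; apply: commrM; apply: commrX. Qed.

Lemma cyclic_sumE : cyclic_sum * a = cyclic_sum * b.
Proof.
pose G s := a ^+ s * b ^+ (d.+1 - s).
have -> : cyclic_sum * a = \sum_(s < d) G s.+1.
  rewrite mulr_suml; apply: eq_bigr => s _.
  by rewrite -mulrA -[_ * a](commrX _ ab) mulrA -exprSr.
have -> : cyclic_sum * b = \sum_(s < d) G s.
  rewrite mulr_suml; apply: eq_bigr => s _.
  by rewrite -mulrA -exprSr /G subSn // ltnW.
have G0 : G 0%N = G d by rewrite /G ad subSnn subn0 exprS bd mulr1 !mul1r.
apply: (@addrI _ (G 0%N)); rewrite [RHS]addrC {2}G0.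
transitivity (\sum_(s < d.+1) G s); first by rewrite big_ord_recl.
by rewrite big_ord_recr.
Qed.

Lemma cyclic_sum_swap g : g * a = b * g -> g * b = a * g -> comm g cyclic_sum.
Proof.
have swapX (x y y' : A) s : x * y = y' * x -> x * y ^+ s = y' ^+ s * x.
  move=> xy; elim: s => [|s IH]; first by rewrite mulr1 mul1r.
  by rewrite exprS mulrA xy -mulrA IH mulrA -exprS.
move=> ga gb; rewrite /GRing.comm mulr_sumr mulr_suml.
under eq_bigr => s _ do rewrite mulrA (swapX _ _ _ s ga) -mulrA (swapX _ _ _ _ gb) mulrA.
rewrite -!mulr_suml; congr (_ * g); apply: (@addIr _ 1).
transitivity (\sum_(s < d.+1) b ^+ s * a ^+ (d - s)).
  by rewrite big_ord_recr /= subnn bd mulr1.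
transitivity (\sum_(s < d.+1) a ^+ s * b ^+ (d - s)); last first.
  by rewrite big_ord_recr /= subnn ad mulr1.
rewrite (reindex_inj rev_ord_inj) /=; apply: eq_bigr => s _.
rewrite subSS subKn; last by rewrite -ltnS.
by apply: commrX; apply: commr_sym; apply: commrX.
Qed.
End Average.

Section YhMatrices.
Variables (F : fieldType) (q : F) (Q : nat -> F) (d l n : nat).
Variable V : rep F (yh_gen n).
Hypothesis q0 : q != 0.
Hypothesis VY : yh_module q Q d l V.
Local Notation N := (rdim V).

Definition gmx (k : nat) : 'M[F]_N := at_nat (fun i => V (Yg i)) k.
Definition tmx (k : nat) : 'M[F]_N := at_nat (fun i => V (Yt i)) k.
Definition Emx (k : nat) : 'M[F]_N :=
  ((q - 1) * d%:R^-1)%:M * cyclic_sum d (tmx k.-1) (tmx k).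

Lemma at_natE (m N' : nat) (T : 'I_m -> 'M[F]_N') (i : 'I_m) : at_nat T i = T i.
Proof. by rewrite /at_nat valK. Qed.

Lemma at_nat_ord (m N' : nat) (T : 'I_m -> 'M[F]_N') k (km : (k < m)%N) :
  at_nat T k = T (Ordinal km).
Proof. exact: (at_natE T (Ordinal km)). Qed.

Let tX k : (k < n)%N -> tmx k ^+ d = 1.
Proof. by move=> kn; have [_ _ tV _ _] := VY; rewrite /tmx (at_nat_ord _ kn); apply: tV. Qed.

Let ttC i j : (i < n)%N -> (j < n)%N -> GRing.comm (tmx i) (tmx j).
Proof.
move=> ii jj; have [_ tV _ _ _] := VY.
by rewrite /tmx (at_nat_ord _ ii) (at_nat_ord _ jj); apply: tV.
Qed.

Lemma ord_predS i (ii : (i.+1 < n)%N) : ord_pred (Ordinal ii) = Ordinal (ltnW ii).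
Proof.
apply: val_inj => /=; rewrite -[RHS](@modn_small i n) ?(ltnW ii) //.
by rewrite modnDr.
Qed.

Lemma yh_module_relations : yh_relations n q%:M q^-1%:M gmx tmx Emx.
Proof.
have [[_ VF VB VB0] _ _ Vgt Vgg] := VY.
have scC (c : F) (x : 'M_N) : GRing.comm c%:M x.
  by rewrite /GRing.comm -[LHS]/(_ *m _) -[RHS]/(_ *m _) mul_scalar_mx mul_mx_scalar.
have gtE i (ii : (i.+1 < n)%N) j (jj : (j < n)%N) : gmx i.+1 * tmx j =
    V (Yt (tperm (Ordinal (ltnW ii)) (Ordinal ii) (Ordinal jj))) * gmx i.+1.
  rewrite /gmx /tmx (at_nat_ord _ ii) (at_nat_ord _ jj).
  by have := Vgt (Ordinal ii) (Ordinal jj); rewrite /= ord_predS.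
have gl i : (i.+1 < n)%N -> gmx i.+1 * tmx i = tmx i.+1 * gmx i.+1.
  move=> ii; rewrite (gtE _ ii _ (ltnW ii)) tpermL.
  by rewrite /tmx (at_nat_ord _ ii).
have gr i : (i.+1 < n)%N -> gmx i.+1 * tmx i.+1 = tmx i * gmx i.+1.
  move=> ii; rewrite (gtE _ ii _ ii) tpermR.
  by rewrite /tmx (at_nat_ord _ (ltnW ii)).
split=> //.
- by rewrite -[LHS]/(_ *m _) -scalar_mxM mulVf.
- move=> i j ij jn; rewrite /gmx (at_nat_ord _ jn).
  have ii : (i < n)%N by apply: leq_trans jn; apply: ltnW; apply: ltnW.
  by rewrite (at_nat_ord _ ii); apply: VF.
- move=> i i0 ii; rewrite /gmx (at_nat_ord _ ii) (at_nat_ord _ (ltnW ii)).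
  exact: (VB (Ordinal (ltnW ii)) (Ordinal ii)).
- move=> n1; rewrite /gmx (at_nat_ord _ n1) (at_nat_ord _ (ltnW n1)).
  exact: (VB0 (Ordinal (ltnW n1)) (Ordinal n1)).
- move=> j jn; have n0 : (0 < n)%N by apply: leq_trans jn.
  rewrite /gmx /tmx (at_nat_ord _ jn) (at_nat_ord _ n0).
  exact: (Vgt (Ordinal n0) (Ordinal jn)).
- move=> i j ii jn ji ji1; rewrite /GRing.comm (gtE _ ii _ jn) tpermD.
  + by rewrite /tmx (at_nat_ord _ jn).
  + by rewrite -val_eqE eq_sym.
  + by rewrite -val_eqE eq_sym.
- move=> i ii; rewrite /gmx (at_nat_ord _ ii) [LHS]Vgg //; congr (_ + _).
  rewrite /Emx /= /cyclic_sum /yh_e /tmx (at_nat_ord _ ii) (at_nat_ord _ (ltnW ii)).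
  rewrite ord_predS -[in RHS]mulrA -[RHS]/(_ *m (_ *m _)) mul_scalar_mx -scalerA.
  by rewrite -scalemxAl.
- move=> i x ii xl xr; apply: commrM; first exact/commr_sym.
  exact: cyclic_sum_comm.
- move=> i ii; apply/commr_sym/commrM; first exact/commr_sym.
  by apply: cyclic_sum_swap; rewrite ?tX ?(ltnW ii) ?gl ?gr //; apply: ttC => //; apply: ltnW.
- move=> i ii; rewrite /Emx /= -!mulrA cyclic_sumE ?tX ?(ltnW ii) //.
  by apply: ttC => //; apply: ltnW.
Qed.

Lemma jmE k : jm q^-1%:M gmx k = jucys_murphy q gmx k.
Proof. by elim: k => //= k ->; rewrite -[LHS]/(_ *m _) mul_scalar_mx. Qed.

End YhMatrices.

(** * Joint eigenvectors *)

Section Eigenvectors.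
Variables (F : fieldType) (N : nat).
Implicit Types (T : 'M[F]_N) (u v : 'cV[F]_N) (U : 'cV[F]_N -> Prop).

(** Subspaces are given as predicates, since eigenvectors will come from known
    annihilating polynomials and not from dimension counts. *)
Definition lin_closed U := forall (a : F) u v, U u -> U v -> U (a *: u + v).

Definition stable U T := forall u, U u -> U (T *m u).

Lemma lin_closedZ U a u : lin_closed U -> U u -> U (a *: u).
Proof.
move=> Ul Uu; have U0 : U 0 by have := Ul (-1) u u Uu Uu; rewrite scaleN1r addNr.
by have := Ul a u 0 Uu U0; rewrite addr0.
Qed.

(** Apply the factors to u one by one: the last nonzero vector is an eigenvector. *)
Lemma split_eigenvector U T (s : seq F) u : lin_closed U -> stable U T -> U u -> u != 0 ->
  (\prod_(a <- s) (T - a%:M)) *m u = 0 ->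
  exists a v, [/\ U v, v != 0 & T *m v = a *: v].
Proof.
move=> Ul UT Uu u0; elim: s => [|a s IH].
  by rewrite big_nil mul1mx => /eqP; rewrite (negbTE u0).
rewrite big_cons -[_ * _]/(_ *m _) -mulmxA.
set v := (\prod_(b <- s) _) *m u => av0.
case: (eqVneq v 0) => [|v0]; first exact: IH.
exists a, v; split=> //; last first.
  by apply/eqP; rewrite -subr_eq0 -mul_scalar_mx -mulmxBl av0.
rewrite /v; elim: s {IH v av0 v0} => [|b s IH]; first by rewrite big_nil mul1mx.
rewrite big_cons -[_ * _]/(_ *m _) -mulmxA mulmxBl mul_scalar_mx addrC -scaleNr.
by apply: Ul => //; apply: UT.
Qed.

Definition joint_eigenvector (fs : nat -> 'M[F]_N) (a : nat -> F) (m : nat) u :=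
  forall i, (i < m)%N -> fs i *m u = a i *: u.

Lemma joint_eigenvector_lin fs a m : lin_closed (joint_eigenvector fs a m).
Proof.
move=> c u v hu hv i im; rewrite mulmxDr -scalemxAr hu // hv //.
by rewrite scalerDr !scalerA mulrC.
Qed.

Lemma joint_eigenvector_stable fs a m T : (forall i, (i < m)%N -> fs i *m T = T *m fs i) ->
  stable (joint_eigenvector fs a m) T.
Proof. by move=> fT u hu i im; rewrite mulmxA fT // -mulmxA hu // -scalemxAr. Qed.

Lemma joint_eigenvectorS fs a m u b : joint_eigenvector fs a m u -> fs m *m u = b *: u ->
  joint_eigenvector fs (fun i => if i == m then b else a i) m.+1 u.
Proof.
move=> hu hm i; rewrite ltnS leq_eqVlt => /orP[/eqP -> |im]; first by rewrite eqxx.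
by rewrite ltn_eqF // hu.
Qed.

Lemma prod_unity_roots d z T : d.-primitive_root z -> T ^+ d = 1 ->
  \prod_(a <- [seq z ^+ i | i <- index_iota 0 d]) (T - a%:M) = 0.
Proof.
case: N T => [|N'] T zd Td; first by rewrite [LHS]flatmx0 [RHS]flatmx0.
have := congr1 (horner_mx T) (factor_Xn_sub_1 zd).
rewrite rmorph_prod rmorphB rmorphXn rmorph1 /= horner_mx_X Td subrr => <-.
rewrite big_map; apply: eq_bigr => i _.
by rewrite rmorphB /= horner_mx_X horner_mx_C.
Qed.

End Eigenvectors.

Section JointEigenvectors.
Variables (F : fieldType) (q : F) (Q : nat -> F) (d l n : nat) (zd : F).
Variable V : rep F (yh_gen n).
Hypothesis q0 : q != 0.
Hypothesis d0 : d%:R != 0 :> F.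
Hypothesis zd_prim : d.-primitive_root zd.
Hypothesis VY : yh_module q Q d l V.
Local Notation N := (rdim V).
Local Notation t := (tmx V).
Local Notation X := (jm q^-1%:M (gmx V)).
Local Notation E := (Emx q d V).
Let rel := yh_module_relations q0 VY.

(** As E t_k = E t_(k+1), E kills u if the two eigenvalues differ; if they agree,
    e_k averages d copies of u. *)
Lemma Emx_eigen k (u : 'cV[F]_N) (a b : F) : (k.+1 < n)%N -> u != 0 ->
  t k *m u = a *: u -> t k.+1 *m u = b *: u ->
  E k.+1 *m u = if a == b then (q - 1) *: u else 0.
Proof.
move=> kn u0 ta tb; case: eqVneq => [ab|ab]; last first.
  have : E k.+1 *m (t k *m u) = E k.+1 *m (t k.+1 *m u).
    by rewrite !mulmxA; congr (_ *m u); apply: (yh_Et rel).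
  rewrite ta tb -!scalemxAr => /eqP; rewrite -subr_eq0 -scalerBl scaler_eq0 subr_eq0.
  by rewrite (negbTE ab) => /eqP.
rewrite -{b}ab in tb.
have pow (T : 'M[F]_N) m : T *m u = a *: u -> T ^+ m *m u = a ^+ m *: u.
  move=> Tu; elim: m => [|m IH]; first by rewrite !expr0 mul1mx scale1r.
  by rewrite !exprS -[_ * _]/(_ *m _) -mulmxA IH -scalemxAr Tu scalerA mulrC.
have ad : a ^+ d = 1.
  have [_ _ td _ _] := VY.
  have := pow (t k) d ta; rewrite {1}/tmx (at_nat_ord _ (ltnW kn)) td mul1mx => /eqP.
  rewrite -{1}[u]scale1r -subr_eq0 -scalerBl scaler_eq0 (negbTE u0) orbF subr_eq0.
  by move/eqP.
rewrite /Emx -[_ * _]/(_ *m _) -mulmxA mul_scalar_mx /cyclic_sum mulmx_suml /=.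
have summand (s : 'I_d) : (t k ^+ s * t k.+1 ^+ (d - s)) *m u = u.
  rewrite -[_ * _]/(_ *m _) -mulmxA pow // -scalemxAr pow // scalerA -exprD.
  by rewrite subnK ?ad ?scale1r // ltnW.
under eq_bigr => s _ do rewrite summand.
by rewrite sumr_const card_ord -scaler_nat scalerA -mulrA mulVf // mulr1.
Qed.

(** Listed in the order in which they can be diagonalised one after the other. *)
Definition ops (i : nat) : 'M[F]_N := if (i < n)%N then t i else X (i - n).

Lemma ops_comm i j : (i < n + n)%N -> (j < n + n)%N -> ops i *m ops j = ops j *m ops i.
Proof.
rewrite /ops => ii jj; case: (ltnP i n) => hi; case: (ltnP j n) => hj.
- exact: (yh_tt rel).
- by apply/esym; apply: (jm_t rel) => //; rewrite ltn_subLR.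
- by apply: (jm_t rel) => //; rewrite ltn_subLR.
- by apply: (jm_comm rel); rewrite ltn_subLR.
Qed.

Let spl := split_eigenvector.

(** A vector of U killed by the intertwiner is killed by its square, which acts
    as a quadratic polynomial in X_(k+2) with roots in F. *)
Lemma intertwiner_kernel_eigenvector k (U : 'cV[F]_N -> Prop) u (a b c : F) : (k.+1 < n)%N ->
  lin_closed U -> stable U (X k.+1) -> U u -> u != 0 ->
  t k *m u = a *: u -> t k.+1 *m u = b *: u -> X k *m u = c *: u ->
  jm_intertwiner q^-1%:M (gmx V) E k *m u = 0 ->
  exists e v, [/\ U v, v != 0 & X k.+1 *m v = e *: v].
Proof.
move=> kn Ul UX Uu u0 ta tb Xc tau0.
have EB : E k.+1 *m X k.+1 = X k.+1 *m E k.+1 by apply: (jm_E rel).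
have XB : X k *m X k.+1 = X k.+1 *m X k by apply: (jm_comm rel) => //; apply: ltnW.
have := congr1 (mulmx^~ u) (jm_intertwiner_sqr rel kn).
rewrite -[_ * _ in LHS]/(_ *m _) -mulmxA tau0 mulmx0.
rewrite -[_ * _ * _ * _]/(_ *m _ *m _ *m _) -[_ * _ * _]/(_ *m _ *m _) => sq0.
have Eu := Emx_eigen kn u0 ta tb.
move: (X k.+1) (E k.+1) EB XB UX sq0 Eu => B EE EB XB UX sq0 Eu.
have Zu : (X k - B) *m u = - ((B - c%:M) *m u).
  by rewrite !mulmxBl Xc mul_scalar_mx opprB.
have ZZu : (X k - B) *m ((X k - B) *m u) = (B - c%:M) *m ((B - c%:M) *m u).
  rewrite Zu mulmxN; set w := (B - _) *m u.
  have Xw : X k *m w = c *: w.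
    by rewrite /w mulmxA mulmxBr XB mul_mx_scalar -mul_scalar_mx -mulmxBl -mulmxA Xc scalemxAr.
  by rewrite mulmxBl Xw -mul_scalar_mx -mulmxBl -mulNmx opprB.
have {}sq0 : q *: ((B - c%:M) *m ((B - c%:M) *m u)) =
    (if a == b then (q - 1) ^+ 2 * c else 0) *: (B *m u).
  have /eqP : 0 = - (q *: ((X k - B) *m ((X k - B) *m u)))
      + EE *m (EE *m (B *m (X k *m u))).
    by rewrite {1}sq0 mulmxDl mulNmx -!mulmxA mul_scalar_mx.
  rewrite eq_sym addrC subr_eq0 ZZu Xc => /eqP <-.
  have EBv v : EE *m (B *m v) = B *m (EE *m v) by rewrite mulmxA EB mulmxA.
  rewrite -!scalemxAr !EBv; case: (a == b) Eu => Eu; last first.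
    by rewrite Eu !mulmx0 scaler0 scale0r.
  by rewrite Eu -!scalemxAr Eu -!scalemxAr !scalerA; congr (_ *: _); ring.
(* The roots are c, twice, if e_k kills u, and q c, q^-1 c if e_k fixes u. *)
case: eqP sq0 => _ sq0; last first.
  apply: (@spl _ _ U B [:: c; c] u) => //.
  rewrite !big_cons big_nil mulr1 -[_ * _]/(_ *m _) -mulmxA.
  by move/eqP: sq0; rewrite scale0r scaler_eq0 (negbTE q0) => /eqP.
apply: (@spl _ _ U B [:: q * c; q^-1 * c] u) => //.
rewrite !big_cons big_nil mulr1 -[_ * _]/(_ *m _) -mulmxA.
have expand e f : (B - e%:M) *m ((B - f%:M) *m u) =
    B *m (B *m u) - (e + f) *: (B *m u) + (e * f) *: u.
  rewrite !mulmxBl !mulmxBr !mul_scalar_mx -scalemxAr scalerA scalerDl.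
  by rewrite opprB opprD !addrA [LHS]addrAC; congr (_ + _); rewrite addrAC.
apply: (scalerI q0); apply/matrixP => i j; move/matrixP: sq0 => /(_ i j).
rewrite !expand scaler0; move: (B *m u) (B *m (B *m u)) => v w.
rewrite !mxE => /eqP; rewrite -subr_eq0 => /eqP sq0; rewrite -[RHS]sq0.
by field.
Qed.

(** Each operator maps the joint eigenspaces of the previous ones to themselves.
    For t_j and X_1 it has an annihilating polynomial that splits.  For X_(k+2),
    the intertwiner maps such an eigenspace, unless it kills a vector of it, onto
    a subspace stable under the previous operators, where X_(k+1) plays the part
    of X_(k+2) and has an eigenvector by induction. *)
Theorem joint_eigenvector_exists m (U : 'cV[F]_N -> Prop) : (m <= n + n)%N -> lin_closed U ->
  (exists2 u, U u & u != 0) -> (forall i, (i < m)%N -> stable U (ops i)) ->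
  exists a u, [/\ U u, u != 0 & joint_eigenvector ops a m u].
Proof.
elim: m U => [|m IH] U mn Ul [u Uu u0] US; first by exists (fun _ => 0), u.
have [|i im|a [{u0}u [{Uu}Uu u0 ua]]] := IH U (ltnW mn) Ul; first by exists u.
  by apply: US; apply: leqW.
suff [e [v [[Uv va] v0 ve]]] : exists e v,
    [/\ U v /\ joint_eigenvector ops a m v, v != 0 & ops m *m v = e *: v].
  by exists (fun i => if i == m then e else a i), v; split=> //; apply: joint_eigenvectorS.
pose W v := U v /\ joint_eigenvector ops a m v.
have Wl : lin_closed W.
  move=> c v w [Uv va] [Uw wa]; split; first exact: Ul.
  exact: joint_eigenvector_lin.
have WS : stable W (ops m).
  move=> v [Uv va]; split; first exact: (US m).
  by apply: joint_eigenvector_stable va => i im; apply: ops_comm => //; apply: ltn_trans mn.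
have Wu : W u by [].
case: (ltnP m n) => [mn'|nm].
  apply: (@spl _ _ W _ ([seq zd ^+ i | i <- index_iota 0 d]) _ Wl WS Wu u0).
  rewrite prod_unity_roots ?mul0mx // /ops mn' /tmx (at_nat_ord _ mn').
  by have [_ _ tV _ _] := VY; apply: tV.
have opsE j : (n <= j)%N -> ops j = X (j - n) by rewrite /ops leqNgt; case: ltnP.
case: (posnP (m - n)) => [mn0|mn0].
  have n0 : (0 < n)%N by lia.
  apply: (@spl _ _ W _ [seq Q (nat_of_ord i) | i <- index_enum (ordinal l)] _ Wl WS Wu u0).
  rewrite big_map opsE // mn0 /= /gmx (at_nat_ord _ n0).
  by have [[X0 _ _ _] _ _ _ _] := VY; rewrite X0 ?mul0mx.
pose k := (m - n).-1.
have kn : (k.+1 < n)%N by rewrite /k; lia.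
have tE i (v : 'cV_N) : (i < n)%N -> W v -> t i *m v = a i *: v.
  by move=> ii [_ va]; rewrite -va ?/ops ?ii //; apply: leq_trans nm.
have XE i (v : 'cV_N) : (i <= k)%N -> W v -> X i *m v = a (n + i)%N *: v.
  move=> ik [_ va]; rewrite -va ?opsE ?leq_addr //; last by rewrite /k in ik; lia.
  by rewrite addKn.
have {}opsE : ops m = X k.+1 by rewrite opsE // /k prednK.
rewrite opsE in WS *.
pose tau := jm_intertwiner q^-1%:M (gmx V) E k.
have swap (P P' R R' : 'M[F]_N) (v : 'cV_N) :
    P *m R = P' *m R' -> P *m (R *m v) = P' *m (R' *m v).
  by rewrite !mulmxA => ->.
have kernel v : W v -> v != 0 -> tau *m v = 0 ->
    exists e v, [/\ W v, v != 0 & X k.+1 *m v = e *: v].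
  move=> Wv v0 tv0.
  apply: (intertwiner_kernel_eigenvector kn Wl WS Wv v0 _ _ _ tv0).
  - by apply: tE => //; apply: ltnW.
  - exact: tE.
  - exact: XE.
case: (eqVneq (tau *m u) 0) => [|tu0]; first exact: kernel.
have [| |i im|b [w [[v Wv ->] tv0 vb]]] :=
    IH (fun w => exists2 v, W v & w = tau *m v) (ltnW mn).
- move=> c _ _ [v Wv ->] [w Ww ->]; exists (c *: v + w); first exact: Wl.
  by rewrite mulmxDr scalemxAr.
- by exists (tau *m u) => //; exists u.
- move=> _ [v Wv ->]; rewrite /ops; case: ltnP => [ii|ni].
    have [j jn tj] := t_jm_intertwiner rel kn ii.
    exists (t j *m v); last exact: swap.
    by rewrite tE //; apply: lin_closedZ.
  have : (i - n <= k)%N by rewrite /k; lia.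
  rewrite leq_eqVlt => /orP[/eqP->|ik].
    exists (X k.+1 *m v); first exact: WS.
    by apply: swap; apply/esym; exact: (jm_intertwinerY rel kn).
  exists (X (i - n) *m v); first by rewrite XE ?(ltnW ik) //; apply: lin_closedZ.
  by apply: swap; apply/esym; exact: (jm_intertwiner_jm rel kn ik).
have v0 : v != 0 by apply: contraNneq tv0 => ->; rewrite mulmx0.
have km : (n + k < m)%N by rewrite /k; lia.
have := vb _ km; rewrite /ops ltnNge leq_addr /= addKn.
set e := b _ => Xtv.
(* The intertwiner takes the same value at X_(k+2) v and at e v: unless v is an
   eigenvector, their difference is a nonzero vector that it kills. *)
case: (eqVneq (X k.+1 *m v - e *: v) 0) => [/eqP|v'0].
  by rewrite subr_eq0 => /eqP; exists e, v.
apply: kernel v'0 _; first by rewrite addrC -scaleNr; apply: Wl => //; apply: WS.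
rewrite mulmxBr -scalemxAr -Xtv; apply/eqP; rewrite subr_eq0; apply/eqP.
by apply: swap; exact: (jm_intertwinerY rel kn).
Qed.

End JointEigenvectors.

(** The eigenspaces of Z are submodules. *)
Lemma simple_scalar (F : fieldType) (G : Type) (V : rep F G) (Z : 'M[F]_(rdim V))
    (u : 'cV[F]_(rdim V)) c :
  is_simple V -> (forall x, V x *m Z = Z *m V x) -> u != 0 -> Z *m u = c *: u -> Z = c%:M.
Proof.
move=> [_ Vsimple] ZV u0 Zu; pose A := Z - c%:M.
pose f := linfun (mulmx A : 'cV[F]_(rdim V) -> 'cV[F]_(rdim V)).
have kerE v : (v \in lker f) = (A *m v == 0).
  by rewrite memv_ker lfunE.
have [x v|lker0|lkerT] := Vsimple (lker f).
- rewrite !kerE mulmxA (_ : A *m V x = V x *m A) -?mulmxA; first by move/eqP->; rewrite mulmx0.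
  by rewrite mulmxBl mulmxBr ZV mul_scalar_mx mul_mx_scalar.
- have : u \in lker f.
    by rewrite kerE mulmxBl Zu mul_scalar_mx subrr.
  by rewrite lker0 memv0 (negbTE u0).
apply/eqP; rewrite -subr_eq0; apply/eqP/matrixP => i j.
have : delta_mx j 0 \in lker f by rewrite lkerT memvf.
by rewrite kerE -colE => /eqP /matrixP /(_ i 0); rewrite !mxE.
Qed.

Section CentralScalars.
Variables (F : fieldType) (q : F) (Q : nat -> F) (d l n : nat) (zd : F).
Variable V : rep F (yh_gen n).
Hypothesis q0 : q != 0.
Hypothesis VY : yh_module q Q d l V.
Local Notation X := (jm q^-1%:M (gmx V)).
Let rel := yh_module_relations q0 VY.

Definition central_mx (m s : nat) : 'M[F]_(rdim V) :=
  color_power_sum n q^-1%:M (gmx V) (tmx V) m s.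

Lemma central_mxC m s x : V x *m central_mx m s = central_mx m s *m V x.
Proof.
case: x => i.
  have := color_power_sum_g rel m s (ltn_ord i); rewrite /gmx at_natE; exact.
have := color_power_sum_t rel m s (ltn_ord i); rewrite {1}/tmx at_natE; exact.
Qed.

Lemma central_mx_eigen m s (a : nat -> F) (u : 'cV_(rdim V)) :
  joint_eigenvector (ops q V) a (n + n) u ->
  central_mx m s *m u = (\sum_(k < n) a (n + k)%N ^+ m * a k ^+ s) *: u.
Proof.
move=> ua.
have pow (T : 'M[F]_(rdim V)) c e : T *m u = c *: u -> T ^+ e *m u = c ^+ e *: u.
  move=> Tu; elim: e => [|e IH]; first by rewrite !expr0 mul1mx scale1r.
  by rewrite !exprS -[_ * _]/(_ *m _) -mulmxA IH -scalemxAr Tu scalerA mulrC.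
rewrite /central_mx /color_power_sum mulmx_suml scaler_suml; apply: eq_bigr => k _.
rewrite -[_ * _ in LHS]/(_ *m _) -mulmxA.
have tk : tmx V k *m u = a k *: u.
  by rewrite -ua ?ltn_addr // /ops ltn_ord.
have Xk : X k *m u = a (n + k)%N *: u.
  by rewrite -ua ?ltn_add2l // /ops ltnNge leq_addr addKn.
by rewrite (pow _ _ _ tk) -scalemxAr (pow _ _ _ Xk) scalerA mulrC.
Qed.

Lemma central_mx_of_eigenvector m s (a : nat -> F) (u : 'cV_(rdim V)) : is_simple V ->
  u != 0 -> joint_eigenvector (ops q V) a (n + n) u ->
  central_mx m s = (\sum_(k < n) a (n + k)%N ^+ m * a k ^+ s)%:M.
Proof.
move=> Vs u0 ua; apply: (simple_scalar Vs _ u0 (central_mx_eigen m s ua)).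
exact: central_mxC.
Qed.

(** V is not known to be absolutely simple; it is the joint eigenvector over F
    which makes the scalar belong to F. *)
Lemma central_mx_scalar m s : is_simple V -> d%:R != 0 :> F -> d.-primitive_root zd ->
  exists c, central_mx m s = c%:M.
Proof.
move=> Vs d0 zd_prim; have [Vpos _] := Vs.
have [||u|a [u [_ u0 ua]]] :=
    joint_eigenvector_exists q0 d0 zd_prim VY (U := fun _ => True) (leqnn _) _ _ _ => //.
  exists (const_mx 1) => //; apply/eqP => /matrixP /(_ (Ordinal Vpos) 0).
  by rewrite !mxE => /eqP; rewrite oner_eq0.
by exists (\sum_(k < n) a (n + k)%N ^+ m * a k ^+ s); apply: central_mx_of_eigenvector ua.
Qed.

End CentralScalars.

(** * The scalars on V^lambda *)

Lemma free_finite_family (F : fieldType) (vT : vectType F) (T : finType) (v : T -> vT)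
    (k : T -> F) :
  free [seq v x | x <- enum predT] -> \sum_x k x *: v x = 0 -> forall x, k x = 0.
Proof.
move=> fr k0 x.
have sz : size [seq v x | x <- enum predT] = #|T| by rewrite size_map -cardE.
have /freeP fP : free (tcast sz (in_tuple [seq v x | x <- enum predT])) by rewrite val_tcast.
rewrite -(enum_rankK x); apply: (fP (fun j => k (enum_val j))).
rewrite -[RHS]k0 (big_enum_val (fun x => k x *: v x)); apply: eq_bigr => j _.
have js : (j < size (enum T))%N by rewrite -cardE.
rewrite val_tcast /= (nth_map x) //; congr (_ *: v _).
exact: set_nth_default.
Qed.

Section TensorAction.
Variables (F : fieldType) (I : finType) (D : I -> nat) (N : nat).
Local Notation idx := {dffun forall i : I, 'I_(D i)}.
Variable v : idx -> 'cV[F]_N.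

(** P acts on the vectors v beta as the endomorphism which is M on the i-th factor
    and the identity on the other ones acts on tensor products of basis vectors. *)
Definition acts_on_factor (i : I) (P : 'M[F]_N) (M : 'M[F]_(D i)) : Prop :=
  forall beta : idx, P *m v beta =
    \sum_(c < D i) M c (beta i) *: v (finfun (dfwith beta c)).

Let upd (beta : idx) (i : I) (c : 'I_(D i)) : idx := finfun (dfwith beta c).

Let updE (beta : idx) i (c : 'I_(D i)) : upd beta c i = c.
Proof. by rewrite ffunE dfwith_in. Qed.

Let updN (beta : idx) i (c : 'I_(D i)) j : i != j -> upd beta c j = beta j.
Proof. by move=> ij; rewrite ffunE dfwith_out. Qed.

Let upd_upd (beta : idx) i (c c' : 'I_(D i)) : upd (upd beta c) c' = upd beta c'.
Proof.
apply/ffunP => j; case: (eqVneq i j) => [<-|ij]; first by rewrite !updE.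
by rewrite !updN.
Qed.

Let upd_id (beta : idx) i : upd beta (beta i) = beta.
Proof.
apply/ffunP => j; case: (eqVneq i j) => [<-|ij]; first by rewrite !updE.
by rewrite !updN.
Qed.

Lemma acts_on_factorM i P P' (M M' : 'M_(D i)) :
  acts_on_factor P M -> acts_on_factor P' M' -> acts_on_factor (P *m P') (M *m M').
Proof.
move=> PM PM' beta; rewrite -mulmxA PM' mulmx_sumr.
under eq_bigr => c _ do rewrite -scalemxAr PM scaler_sumr.
rewrite exchange_big /=; apply: eq_bigr => c' _; rewrite mxE scaler_suml.
apply: eq_bigr => c _; rewrite -/(upd beta c) -/(upd (upd beta c) c') -/(upd beta c').
by rewrite upd_upd updE scalerA mulrC.
Qed.

Lemma acts_on_factorZ i a P (M : 'M_(D i)) :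
  acts_on_factor P M -> acts_on_factor (a *: P) (a *: M).
Proof.
move=> PM beta; rewrite -scalemxAl PM scaler_sumr.
by apply: eq_bigr => c _; rewrite mxE scalerA.
Qed.

Variable w : forall i : I, 'cV[F]_(D i).

Definition tensor_vector : 'cV[F]_N := \sum_(beta : idx) (\prod_i w i (beta i) 0) *: v beta.

(** Both sides are compared through the involution which exchanges the new value
    c with the old value beta i. *)
Lemma tensor_vector_eigen i P (M : 'M_(D i)) a :
  acts_on_factor P M -> M *m w i = a *: w i -> P *m tensor_vector = a *: tensor_vector.
Proof.
move=> PM Mw; rewrite /tensor_vector mulmx_sumr scaler_sumr.
under eq_bigr => beta _ do rewrite -scalemxAr PM scaler_sumr.
rewrite pair_big /=.
pose h (x : idx * 'I_(D i)) : idx * 'I_(D i) := (upd x.1 x.2, x.1 i).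
have hK : cancel h h.
  by case=> beta c; rewrite /h /= upd_upd upd_id updE.
rewrite (reindex_inj (can_inj hK)) /= -(pair_big predT predT
   (fun beta c => (\prod_j w j (upd beta c j) 0) *: (M (beta i) (upd beta c i) *:
     v (finfun (dfwith (upd beta c) (beta i)))))) /=.
apply: eq_bigr => beta _.
rewrite scalerA (bigD1 i) //= mulrA.
have -> : a * w i (beta i) 0 = (M *m w i) (beta i) 0 by rewrite Mw mxE.
rewrite mxE mulr_suml scaler_suml; apply: eq_bigr => c _.
rewrite -/(upd (upd beta c) (beta i)) upd_upd upd_id updE scalerA; congr (_ *: _).
rewrite (bigD1 i) //= updE mulrC mulrA; congr (_ * _).
by apply: eq_bigr => j ji; rewrite updN // eq_sym.
Qed.

Lemma tensor_vector_neq0 : free [seq v beta | beta <- enum predT] ->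
  (forall i, w i != 0) -> tensor_vector != 0.
Proof.
move=> fr w0.
have ent i : exists c, w i c 0 != 0.
  apply/existsP; apply: contra_neqT (w0 i); rewrite negb_exists => /forallP wc.
  by apply/matrixP => c j; rewrite ord1 mxE; apply/eqP; have := wc c; rewrite negbK.
(* The coefficient of v f does not vanish. *)
have [f fP] : exists f : forall i, 'I_(D i), forall i, w i (f i) 0 != 0.
  by exists (fun i => xchoose (ent i)) => i; apply: (xchooseP (ent i)).
apply/eqP => T0; have /= := free_finite_family fr T0 (finfun f : idx).
apply/eqP/prodf_neq0 => i _; rewrite ffunE; exact: fP.
Qed.

Lemma tensor_vector_span : tensor_vector \in <<[seq v beta | beta <- enum predT]>>%VS.
Proof.
apply: memv_suml => beta _; apply: memvZ; apply: memv_span.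
by apply: map_f; rewrite mem_enum.
Qed.

End TensorAction.

Lemma size_part_nodes p : size (part_nodes p) = sumn p.
Proof.
rewrite size_allpairs_dep; congr sumn; rewrite -[RHS](mkseq_nth 0%N).
by rewrite /mkseq; apply: eq_map => i /=; rewrite size_iota.
Qed.

Lemma size_nodes nu : size (nodes nu) = msum nu.
Proof.
rewrite size_allpairs_dep /msum; congr sumn.
rewrite -[nu in RHS](mkseq_nth [::]) /mkseq -map_comp; apply: eq_map => a /=.
exact: size_part_nodes.
Qed.

Lemma msum_cat nu nu' : msum (nu ++ nu') = (msum nu + msum nu')%N.
Proof. by rewrite /msum map_cat sumn_cat. Qed.

Lemma moffsetE l lam i : moffset l lam i = msum (take (i * l) lam).
Proof.
elim: i => [|i IH]; first by rewrite /moffset big_ord0 mul0n take0.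
by rewrite /moffset big_ord_recr /= -/(moffset l lam i) IH mulSnr takeD msum_cat.
Qed.

Lemma moffset_full d l lam n : is_multipartition (d * l) n lam -> moffset l lam d = n.
Proof.
by case/and3P => /eqP sl _ /eqP <-; rewrite moffsetE -sl take_size.
Qed.

Lemma moffset_le l lam i j : (i <= j)%N -> (moffset l lam i <= moffset l lam j)%N.
Proof.
move=> ij; rewrite !moffsetE -(subnKC ij) mulnDl takeD msum_cat.
exact: leq_addr.
Qed.

Lemma mblock_multipartition d l lam n i : is_multipartition (d * l) n lam -> (i < d)%N ->
  size (mblock l lam i) = l /\ all is_partition (mblock l lam i).
Proof.
case/and3P => /eqP sl al _ id; split.
  rewrite size_takel // size_drop sl -mulnBl leq_pmull ?subn_gt0 //.
by apply/allP => p /mem_take /mem_drop; apply: (allP al).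
Qed.

Lemma big_moffset (V : zmodType) l lam i (G : nat -> V) :
  \sum_(k < moffset l lam i) G k =
  \sum_(j < i) \sum_(k < msum (mblock l lam j)) G (moffset l lam j + k)%N.
Proof.
elim: i => [|i IH]; first by rewrite /moffset !big_ord0.
rewrite big_ord_recr /= -IH.
have -> : moffset l lam i.+1 = (moffset l lam i + msum (mblock l lam i))%N.
  by rewrite /moffset big_ord_recr.
by rewrite big_split_ord.
Qed.

Lemma moffset_block l lam i k : (k < moffset l lam i)%N ->
  exists j k', [/\ (j < i)%N, (k' < msum (mblock l lam j))%N & k = (moffset l lam j + k')%N].
Proof.
elim: i => [|i IH] ki; first by rewrite /moffset big_ord0 in ki.
case: (ltnP k (moffset l lam i)) => [/IH[j [k' [ji kk ->]]]|ik].
  by exists j, k'; split=> //; apply: ltnW.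
exists i, (k - moffset l lam i)%N; split=> //; last by rewrite subnKC.
by rewrite ltn_subLR //; move: ki; rewrite /moffset big_ord_recr.
Qed.

Section Labelled.
Variables (F : fieldType) (q : F) (Q : nat -> F) (d l n : nat) (zd : F).
Variables (lam : seq (seq nat)) (V : rep F (yh_gen n)).
Hypothesis q0 : q != 0.
Hypothesis lam_part : is_multipartition (d * l) n lam.
Hypothesis V_lam : yh_labelled q Q d l zd lam V.
Local Notation o := (moffset l lam).

(** Take the tensor product of basis vectors of the V^lambda[i], one standard
    tableau s i for each i. *)
Lemma labelled_eigenvector : exists (u : 'cV[F]_(rdim V)) (s : 'I_d -> seq node),
  [/\ u != 0, forall i, perm_eq (s i) (nodes (mblock l lam i)) &
    forall (i : 'I_d) k, (k < msum (mblock l lam i))%N ->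
      tmx V (o i + k) *m u = zd ^+ i *: u /\
      jm q^-1%:M (gmx V) (o i + k) *m u = content q Q (nth (0, (0, 0))%N (s i) k) *: u].
Proof.
have [VY Vs [W [Wlab [v [Xfree Xspan Wact]]]]] := V_lam.
have pick i : exists sw : seq node * 'cV[F]_(rdim (W i)),
   [/\ perm_eq sw.1 (nodes (mblock l lam i)), sw.2 != 0 &
     forall k, (k < msum (mblock l lam i))%N ->
     jucys_murphy q (at_nat (W i)) k *m sw.2 = content q Q (nth (0, (0, 0))%N sw.1 k) *: sw.2].
  have [_ [Wpos _] [b [bb bE]]] := Wlab i.
  case tE : (std_tableaux (mblock l lam i)) => [|s ss].
    move: bb; rewrite tE => /span_basis; rewrite span_nil => full0.
    have : (const_mx 1 : 'cV[F]_(rdim (W i))) \in fullv by apply: memvf.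
    rewrite -full0 memv0 => /eqP/matrixP /(_ (Ordinal Wpos) 0).
    by rewrite !mxE => /eqP; rewrite oner_eq0.
  have sin : s \in std_tableaux (mblock l lam i) by rewrite tE mem_head.
  exists (s, b s); split=> /=.
  - by move: sin; rewrite mem_filter mem_permutations => /andP[].
  - apply/eqP => bs0; have := basis_free bb; rewrite tE /= free_cons bs0 mem0v.
    by [].
  - by move=> k km; apply: bE.
have [sw swP] := fin_all_exists pick.
pose u := tensor_vector v (fun i => (sw i).2).
have wu : weight_vector d l zd lam u by apply/Xspan; apply: tensor_vector_span.
exists u, (fun i => (sw i).1); split.
- by apply: tensor_vector_neq0 => // i; case: (swP i).
- by move=> i; case: (swP i).
move=> i k km.
have om : (o i + msum (mblock l lam i))%N = o i.+1 by rewrite /moffset big_ord_recr.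
have okn : (o i + k < n)%N.
  rewrite -(moffset_full lam_part); apply: leq_trans (moffset_le l lam (ltn_ord i)).
  by rewrite -om ltn_add2l.
split.
  rewrite /tmx (at_nat_ord _ okn); apply: wu => /=.
  by rewrite leq_addr -om ltn_add2l.
have act : acts_on_factor v (jucys_murphy q (gmx V) (o i + k)) (jucys_murphy q (at_nat (W i)) k).
  elim: k km {okn} => [|k IH] km.
    move=> beta; rewrite addn0 (Wact i (Ordinal km) beta) /= (at_nat_ord _ km).
    by [].
  rewrite addnS /=; apply: acts_on_factorZ.
  have gact : acts_on_factor v (gmx V (o i + k).+1) (at_nat (W i) k.+1).
    by move=> beta; have := Wact i (Ordinal km) beta; rewrite /= addnS (at_nat_ord _ km).
  by apply: acts_on_factorM => //; apply: acts_on_factorM => //; apply: IH; apply: ltnW.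
rewrite jmE; apply: (tensor_vector_eigen act).
by case: (swP i) => _ _; apply.
Qed.

(** Central elements act on V^lambda by scalars, which can be read off the single
    eigenvector of [labelled_eigenvector]; its eigenvalues are the contents of the
    nodes of a tableau for the X_k, and their colours for the t_k. *)
Theorem central_mx_labelled m s : central_mx q V m s =
  (\sum_(i < d) \sum_(x <- nodes (mblock l lam i)) content q Q x ^+ m * (zd ^+ i) ^+ s)%:M.
Proof.
have [u [sq [u0 sqP uE]]] := labelled_eigenvector.
have [VY Vs _] := V_lam.
have full := moffset_full lam_part.
have locate k : (k < n)%N -> exists j k',
    [/\ (j < d)%N, (k' < msum (mblock l lam j))%N & k = (o j + k')%N].
  by move=> kn; apply: moffset_block; rewrite full.
have eig j : exists a, (j < n + n)%N -> ops q V j *m u = a *: u.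
  case: (ltnP j n) => [jn|nj].
    have [i [k [id km jE]]] := locate _ jn.
    exists (zd ^+ i) => _; rewrite /ops jn jE.
    by case: (uE (Ordinal id) k km).
  case: (ltnP j (n + n)) => [jn|]; last by exists 0.
  have jn' : (j - n < n)%N by rewrite ltn_subLR.
  have [i [k [id km jE]]] := locate _ jn'.
  exists (content q Q (nth (0, (0, 0))%N (sq (Ordinal id)) k)) => _.
  rewrite /ops ltnNge nj /= jE.
  by case: (uE (Ordinal id) k km).
have [a aP] := choice eig.
have ua : joint_eigenvector (ops q V) a (n + n) u by move=> j; apply: aP.
rewrite (central_mx_of_eigenvector q0 VY m s Vs u0 ua); congr (_%:M).
have sumE (G : nat -> F) : \sum_(k < n) G k = \sum_(k < o d) G k by rewrite full.
rewrite (sumE (fun k => a (n + k)%N ^+ m * a k ^+ s)).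
rewrite (big_moffset l lam d (fun k => a (n + k)%N ^+ m * a k ^+ s)).
apply: eq_bigr => i _; rewrite -(perm_big _ (sqP i)) /= (big_nth (0, (0, 0))%N) big_mkord.
rewrite (perm_size (sqP i)) size_nodes; apply: eq_bigr => k _.
have [tk Xk] := uE i k (ltn_ord k).
have kn : (o i + k < n)%N.
  rewrite -full; apply: leq_trans (moffset_le l lam (ltn_ord i)).
  by rewrite /moffset big_ord_recr ltn_add2l /=.
have inj c c' : c *: u = c' *: u -> c = c'.
  by move/eqP; rewrite -subr_eq0 -scalerBl scaler_eq0 (negbTE u0) orbF subr_eq0 => /eqP.
congr (_ ^+ m * _ ^+ s); apply: inj.
  by rewrite -Xk -ua ?ltn_add2l // /ops ltnNge leq_addr addKn.
by rewrite -tk -ua ?ltn_addr // /ops kn.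
Qed.

End Labelled.

(** * Descent of scalars to composition factors *)

Section RelatedModules.
Variables (F F' : fieldType) (n : nat) (q : F) (q' : F').
Variables (V : rep F (yh_gen n)) (V' : rep F' (yh_gen n)).
Variable Rel : 'M[F]_(rdim V) -> 'M[F']_(rdim V') -> Prop.
Hypothesis Rel0 : Rel 0 0.
Hypothesis Rel1 : Rel 1%:M 1%:M.
Hypothesis RelD : forall A B A' B', Rel A A' -> Rel B B' -> Rel (A + B) (A' + B').
Hypothesis RelM : forall A B A' B', Rel A A' -> Rel B B' -> Rel (A *m B) (A' *m B').
Hypothesis Relq : Rel q^-1%:M q'^-1%:M.
Hypothesis RelV : forall x, Rel (V x) (V' x).

(** The central elements are polynomials in the generators and q^-1.  This is
    applied to specialisations of entries and of traces, to isomorphisms and to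
    quotients of submodules. *)
Lemma central_mx_related m s : Rel (central_mx q V m s) (central_mx q' V' m s).
Proof.
have at_rel T k : (forall i : 'I_n, Rel (V (T i)) (V' (T i))) ->
    Rel (at_nat (fun i => V (T i)) k) (at_nat (fun i => V' (T i)) k).
  by move=> TT; rewrite /at_nat; case: insubP => [i _ _|_].
have gg k : Rel (gmx V k) (gmx V' k) by apply: at_rel.
have tt k : Rel (tmx V k) (tmx V' k) by apply: at_rel.
have XX k : Rel (jm q^-1%:M (gmx V) k) (jm q'^-1%:M (gmx V') k).
  by elim: k => //= k IH; apply: RelM => //; apply: RelM => //; apply: RelM.
have pow A A' e : Rel A A' -> Rel (A ^+ e) (A' ^+ e).
  by move=> AA; elim: e => [|e IH]; rewrite ?expr0 // !exprS; apply: RelM.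
rewrite /central_mx /color_power_sum; elim/big_ind2: _ => // [? ? ? ?|k _].
  exact: RelD.
by apply: RelM; apply: pow.
Qed.

End RelatedModules.

Section Transfer.
Variables (A : idomainType) (k : fieldType) (f : {rmorphism A -> k}).
Hypothesis k_char0 : forall m, (m%:R == 0 :> k) = (m == 0%N).
Variables (n : nat) (q : {fraction A}) (q' : k).
Hypothesis q'0 : q' != 0.
Hypothesis qq : specialises f q q'.

(** Traces of words determine the traces of the central elements, hence the
    scalars by which they act. *)
Lemma central_mx_trace (V : rep {fraction A} (yh_gen n)) (V' : rep k (yh_gen n)) m s x x' y :
  (0 < rdim V')%N ->
  (forall w, specialises f (\tr (rep_word V w)) (\tr (rep_word V' w))) ->
  central_mx q V m s = x%:M -> specialises f x x' -> central_mx q' V' m s = y%:M -> y = x'.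
Proof.
move=> Vpos trw Vx xx Vy.
pose T (B : 'M_(rdim V)) (B' : 'M_(rdim V')) :=
  forall w, specialises f (\tr (rep_word V w *m B)) (\tr (rep_word V' w *m B')).
have T1 : T 1%:M 1%:M by move=> w; rewrite !mulmx1.
have TV g B B' : T B B' -> T (V g *m B) (V' g *m B').
  (* Prefixing B by a generator lengthens the word in front of it. *)
  move=> TB w; have wg (G : fieldType) (W : rep G (yh_gen n)) :
    rep_word W w *m W g = rep_word W (rcons w g).
    rewrite /rep_word -cats1 foldr_cat /= mulmx1.
    elim: w {trw} => [|h w IH] /=; first by rewrite mul1mx.
    by rewrite -mulmxA IH.
  by rewrite !mulmxA !wg; apply: TB.
(* Traces are not multiplicative; the relation that B and B' preserve T when they
   multiply on the left is. *)
have H : forall C C', T C C' -> T (central_mx q V m s *m C) (central_mx q' V' m s *m C').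
  apply: (@central_mx_related _ _ n q q' V V'
    (fun B B' => forall C C', T C C' -> T (B *m C) (B' *m C'))).
  - by move=> C C' _ w; rewrite !mul0mx !mulmx0 !mxtrace0; apply: specialises0.
  - by move=> C C'; rewrite !mul1mx.
  - move=> B D B' D' TB TD C C' TC w; rewrite !mulmxDl !mulmxDr !mxtraceD.
    by apply: specialisesD; [apply: TB | apply: TD].
  - by move=> B D B' D' TB TD C C' TC; rewrite -!mulmxA; apply: TB; apply: TD.
  - move=> C C' TC w; rewrite !mul_scalar_mx -!scalemxAr !mxtraceZ.
    by apply: specialisesM => //; apply: specialisesV.
  - by move=> g C C'; apply: TV.
have := H _ _ T1 [::]; rewrite !mulmx1 !mul1mx Vx Vy !mxtrace_scalar => trxy.
have := trw [::]; rewrite /= !mxtrace_scalar => tr1.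
have dimE : (rdim V)%:R = (rdim V')%:R :> k.
  by apply: specialises_inj tr1; have := specialises_tofrac f (rdim V)%:R; rewrite !rmorph_nat.
rewrite -[x *+ _]mulr_natr -[y *+ _]mulr_natr in trxy.
have := specialises_inj trxy (specialisesM xx (specialises_nat f _)).
by rewrite dimE; apply: mulIf; rewrite k_char0 -lt0n.
Qed.

(** The decomposition number is chosen among the multiplicities of M in the
    reductions of V, so one of these is not 0. *)
Lemma decomposition_number_neq0 (G : Type) (V : rep {fraction A} G) (M : rep k G) :
  decomposition_number f V M != 0%N ->
  exists W, reduction f V W /\ exists U U' : {vspace 'cV[k]_(rdim W)},
    submodule U' /\ quotient_iso U U' M.
Proof.
rewrite /decomposition_number; case: xgetP => [m _ [W [VW [s [[_ sP] mE]]]] m0|]; last first.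
  by rewrite eqxx.
exists W; split=> //; rewrite mE in m0.
have [i Mi] : exists i : 'I_(size s), quotient_iso (nth 0%VS (0%VS :: s) i) (nth 0%VS s i) M.
  apply: contrapT => none; move/eqP: m0; apply; apply: big1 => i _.
  by apply/eqP; rewrite eqb0; apply/asboolP => Mi; apply: none; exists i.
exists (nth 0%VS (0%VS :: s) i), (nth 0%VS s i); split=> //.
by have [] := sP i (ltn_ord i).
Qed.

(** The central elements commute with the maps that relate V to the lattice, the
    lattice to its reduction, and a submodule of that to the factor M. *)
Lemma central_mx_decomposition (V : rep {fraction A} (yh_gen n)) (M : rep k (yh_gen n)) m s x :
  decomposition_number f V M != 0%N -> (0 < rdim M)%N -> central_mx q V m s = x%:M ->
  exists2 y, specialises f x y & central_mx q' M m s = y%:M.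
Proof.
move=> /decomposition_number_neq0[W [[S [[B [C [BC CB VB]]] SW]] [U [U' [U'sub UM]]]]].
have {UM} [h [hU' _ hM]] := UM; move=> Mpos Vx.
have Sx : central_mx q (Rep S) m s = x%:M.
  have : central_mx q V m s *m B = B *m central_mx q (Rep S) m s.
    apply: (central_mx_related (Rel := fun X Y => X *m B = B *m Y)) => //.
    - by rewrite mul0mx mulmx0.
    - by rewrite mul1mx mulmx1.
    - by move=> X Y X' Y' XX YY; rewrite mulmxDl mulmxDr XX YY.
    - by move=> X Y X' Y' XX YY; rewrite -mulmxA YY !mulmxA XX.
    - by rewrite mul_scalar_mx mul_mx_scalar.
  rewrite Vx mul_scalar_mx -mul_mx_scalar => /(congr1 (mulmx C)).
  by rewrite !mulmxA CB !mul1mx => <-.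
have SWz : specialises_mx f (central_mx q (Rep S) m s) (central_mx q' W m s).
  apply: (@central_mx_related _ _ n q q' (Rep S) W
    (fun X Y => specialises_mx f (X : 'M_(rdim W)) Y)) => //.
  - by move=> i j; rewrite !mxE; apply: specialises0.
  - exact: specialises_mx1.
  - by move=> *; apply: specialises_mxD.
  - by move=> *; apply: specialises_mxM.
  - by rewrite -![_^-1%:M]scalemx1; apply: specialises_mxZ;
      [apply: specialisesV | apply: specialises_mx1].
have [u0 u0U u0n] : exists2 u, u \in U' & h u != 0.
  apply: contrapT => none.
  have : (const_mx 1 : 'cV[k]_(rdim M)) \in (h @: U')%VS by rewrite hU' memvf.
  move=> /memv_imgP[u uU uE]; apply: none; exists u => //; rewrite -uE.
  by apply/eqP => /matrixP /(_ (Ordinal Mpos) 0); rewrite !mxE => /eqP; rewrite oner_eq0.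
have Wpos : (0 < rdim W)%N.
  case: (posnP (rdim W)) => // W0; move/eqP: u0n; case.
  suff -> : u0 = 0 by rewrite linear0.
  by apply/matrixP => i; have := ltn_ord i; rewrite {2}W0.
pose y := central_mx q' W m s (Ordinal Wpos) (Ordinal Wpos).
have xy : specialises f x y by have := SWz (Ordinal Wpos) (Ordinal Wpos); rewrite Sx mxE eqxx.
have Wy : central_mx q' W m s = y%:M.
  apply/matrixP => i j; have := SWz i j; rewrite Sx !mxE; case: eqP => _.
    by move=> xz; apply: specialises_inj xz xy.
  by move=> z0; apply: specialises_inj z0 (specialises0 f).
exists y => //.
have WM u : u \in U' -> h (central_mx q' W m s *m u) = central_mx q' M m s *m h u.
  suff : forall u, u \in U' -> (central_mx q' W m s *m u) \in U' /\
     h (central_mx q' W m s *m u) = central_mx q' M m s *m h u by move=> H /H[].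
  apply: (central_mx_related (Rel := fun X Y => forall u, u \in U' -> X *m u \in U' /\
     h (X *m u) = Y *m h u)).
  - by move=> {}u _; rewrite !mul0mx mem0v linear0.
  - by move=> {}u; rewrite !mul1mx.
  - move=> X Y X' Y' XX YY v vU; have [? Xv] := XX _ vU; have [? Yv] := YY _ vU.
    by rewrite !mulmxDl memvD // linearD /= Xv Yv.
  - move=> X Y X' Y' XX YY v vU; have [YU Yv] := YY _ vU; have [XU Xv] := XX _ YU.
    by rewrite -!mulmxA XU Xv Yv.
  - by move=> v vU; rewrite !mul_scalar_mx memvZ // linearZ.
  - by move=> g v vU; split; [apply: U'sub | apply: hM].
apply/eqP; rewrite -subr_eq0; apply/eqP/matrixP => i j.
have : (delta_mx j 0 : 'cV[k]_(rdim M)) \in (h @: U')%VS by rewrite hU' memvf.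
move=> /memv_imgP[u uU uE].
have : (central_mx q' M m s - y%:M) *m delta_mx j 0 = 0 :> 'cV_(rdim M).
  by rewrite uE mulmxBl -WM // Wy !mul_scalar_mx linearZ subrr.
by rewrite -colE => /matrixP /(_ i 0); rewrite !mxE.
Qed.

End Transfer.

(** * Power sums and multisets *)

Section PowerSums.
Variable F : fieldType.

Lemma poly_sums (I J : Type) (r : seq I) (r' : seq J) (a c : I -> F) (a' c' : J -> F)
    (p : {poly F}) :
  (forall m, \sum_(i <- r) c i * a i ^+ m = \sum_(i <- r') c' i * a' i ^+ m) ->
  \sum_(i <- r) c i * p.[a i] = \sum_(i <- r') c' i * p.[a' i].
Proof.
move=> eqm; under eq_bigr => i _ do rewrite horner_coef mulr_sumr.
under [RHS]eq_bigr => i _ do rewrite horner_coef mulr_sumr.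
rewrite exchange_big [RHS]exchange_big /=; apply: eq_bigr => m _.
under eq_bigr => i _ do rewrite mulrCA.
under [RHS]eq_bigr => i _ do rewrite mulrCA.
by rewrite -!mulr_sumr eqm.
Qed.

(** The Lagrange polynomial of the list at x, up to a constant. *)
Definition separating (s : seq F) (x : F) : {poly F} := \prod_(y <- s | y != x) ('X - y%:P).

Lemma separating_neq0 s x : (separating s x).[x] != 0.
Proof.
rewrite horner_prod prodf_seq_neq0; apply/allP => y _; apply/implyP => yx.
by rewrite hornerXsubC subr_eq0 eq_sym.
Qed.

Lemma separating_eq0 s x y : y \in s -> y != x -> (separating s x).[y] = 0.
Proof.
move=> ys yx; rewrite horner_prod (big_rem y) //= yx hornerXsubC subrr mul0r.
by [].
Qed.

Hypothesis char0 : forall m, (m%:R == 0 :> F) = (m == 0%N).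

Lemma natr_inj_char0 m m' : m%:R = m'%:R :> F -> m = m'.
Proof.
wlog le : m m' / (m <= m')%N => [wl|].
  by case: (leqP m m') => [|/ltnW] le e; [|apply/esym]; apply: wl.
move=> /eqP; rewrite eq_sym -subr_eq0 -natrB // char0 subn_eq0 => le'.
by apply/eqP; rewrite eqn_leq le.
Qed.

(** Power sums determine the sums of the values of every polynomial, and those of
    separating polynomials are the multiplicities. *)
Lemma power_sums_perm (s s' : seq F) :
  (forall m, \sum_(x <- s) x ^+ m = \sum_(x <- s') x ^+ m) -> perm_eq s s'.
Proof.
move=> eqm; have sums x : \sum_(y <- s) 1 * (separating (s ++ s') x).[y] =
    \sum_(y <- s') 1 * (separating (s ++ s') x).[y].
  apply: poly_sums => m.
  by under eq_bigr => i _ do rewrite mul1r; under [RHS]eq_bigr => i _ do rewrite mul1r.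
have count_sum (r : seq F) x : {subset r <= s ++ s'} ->
    \sum_(y <- r) 1 * (separating (s ++ s') x).[y] =
    (separating (s ++ s') x).[x] * (count_mem x r)%:R.
  move=> rs; rewrite -sum1_count natr_sum mulr_sumr [RHS]big_mkcond /=.
  apply: eq_big_seq => y yr; rewrite mul1r; case: eqVneq => [->|yx]; first by rewrite mulr1.
  exact: separating_eq0 (rs _ yr) yx.
apply/allP => x _ /=; apply/eqP/natr_inj_char0; apply: (mulfI (separating_neq0 (s ++ s') x)).
rewrite -!count_sum ?sums // => y ys; rewrite mem_cat ys ?orbT //.
Qed.

(** A polynomial in the colour which vanishes at all the colours but one isolates
    the power sums of that colour. *)
Lemma colored_power_sums_perm d (z : F) (s s' : 'I_d -> seq F) : d.-primitive_root z ->
  (forall m e, \sum_(i < d) \sum_(x <- s i) x ^+ m * (z ^+ i) ^+ e =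
               \sum_(i < d) \sum_(x <- s' i) x ^+ m * (z ^+ i) ^+ e) ->
  forall i, perm_eq (s i) (s' i).
Proof.
move=> zd eqme i0; apply: power_sums_perm => m.
pose g := separating [seq z ^+ (i : 'I_d) | i <- index_enum 'I_d] (z ^+ i0).
have g0 : g.[z ^+ i0] != 0 by apply: separating_neq0.
have gi (i : 'I_d) : i != i0 -> g.[z ^+ i] = 0.
  move=> ii; apply: separating_eq0; first by apply: map_f; rewrite mem_index_enum.
  by rewrite (eq_prim_root_expr zd) !modn_small.
have ext (r : 'I_d -> seq F) : \sum_(i < d) (\sum_(x <- r i) x ^+ m) * g.[z ^+ i] =
    (\sum_(x <- r i0) x ^+ m) * g.[z ^+ i0].
  rewrite (bigD1 i0) //= [X in _ + X]big1 ?addr0 // => i ii.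
  by rewrite gi // mulr0.
apply: (mulIf g0); rewrite -!ext; apply: poly_sums => e.
by have := eqme m e; under eq_bigr => i _ do rewrite -mulr_suml;
  under [X in _ = X -> _]eq_bigr => i _ do rewrite -mulr_suml.
Qed.

End PowerSums.

(** * The specialisations phi and theta *)

Section SchurSpecialises.
Variables (A : idomainType) (k : fieldType) (f : {rmorphism A -> k}).
Variables (q : {fraction A}) (Q : nat -> {fraction A}) (q' : k) (Q' : nat -> k) (l : nat).
Hypotheses (q'0 : q' != 0) (Q'0 : forall a, (a < l)%N -> Q' a != 0).
Hypotheses (qq : specialises f q q') (QQ : forall a, (a < l)%N -> specialises f (Q a) (Q' a)).

Lemma ak_schur_specialises nu : specialises f (ak_schur q Q l nu) (ak_schur q' Q' l nu).
Proof.
apply: specialisesM; first apply: specialisesM.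
- by apply: specialisesXn; apply: specialisesN; apply: specialises1.
- by apply: specialisesV; [rewrite expf_neq0 | apply: specialisesXn].
apply: specialises_prod => a _; apply: specialises_prod => x _; apply: specialisesM.
  by apply: specialises_sum => s _; apply: specialisesXn.
apply: specialises_prod => b _; apply: specialisesB; last exact: specialises1.
apply: specialisesM; last by apply: specialisesV; [apply: Q'0 | apply: QQ].
by apply: specialisesM; [apply: specialisesXz | apply: QQ].
Qed.

Lemma yh_schur_specialises d n lam :
  specialises f (yh_schur q Q d l n lam) (yh_schur q' Q' d l n lam).
Proof.
apply: specialisesM; first by apply: specialisesXn; apply: specialises_nat.
by apply: specialises_prod => i _; apply: ak_schur_specialises.
Qed.

Lemma content_specialises x : (x.1 < l)%N ->
  specialises f (content q Q x) (content q' Q' x).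
Proof. by move=> xl; apply: specialisesM; [apply: specialisesXz | apply: QQ]. Qed.

Lemma content_sum_specialises d lam n m s (z : {fraction A}) z' :
  is_multipartition (d * l) n lam -> specialises f z z' ->
  specialises f
   (\sum_(i < d) \sum_(x <- nodes (mblock l lam i)) content q Q x ^+ m * (z ^+ i) ^+ s)
   (\sum_(i < d) \sum_(x <- nodes (mblock l lam i)) content q' Q' x ^+ m * (z' ^+ i) ^+ s).
Proof.
move=> lamP zz; apply: specialises_sum => i _.
have [sl _] := mblock_multipartition lamP (ltn_ord i).
rewrite big_seq [X in specialises _ _ X]big_seq; apply: specialises_sum => x xl.
apply: specialisesM; apply: specialisesXn; last exact: specialisesXn.
apply: content_specialises.
by case/allpairsPdep: xl => a [y [ai _ ->]] /=; move: ai; rewrite mem_iota sl.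
Qed.

End SchurSpecialises.

Section PhiTheta.
Variables (K : fieldExtType rat) (L : fieldExtType K) (zeta : K) (etaL : L).
Variables (d l : nat) (rr : l.-tuple int) (r : int).

Let phi0 : {rmorphism K -> Ky K} := @tofrac {poly K} \o polyC.

Let h0 (a : 'I_l.+1) : Ky K := if (a < l)%N then phiQ zeta d rr a else phiq K r.

Let phiE p : phi zeta d rr r p = mmap phi0 h0 p. Proof. by []. Qed.

Lemma phi_is_zmod_morphism : zmod_morphism (phi zeta d rr r).
Proof. by move=> p p'; rewrite !phiE mmapB. Qed.

Lemma phi_is_monoid_morphism : monoid_morphism (phi zeta d rr r).
Proof.
have [phiM phi1] := mmap_is_multiplicative h0 phi0.
by split=> [|p p']; rewrite !phiE; [exact: phi1 | exact: phiM].
Qed.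

HB.instance Definition _ := GRing.isZmodMorphism.Build (mpoly l.+1 K) (Ky K)
  (phi zeta d rr r) phi_is_zmod_morphism.
HB.instance Definition _ := GRing.isMonoidMorphism.Build (mpoly l.+1 K) (Ky K)
  (phi zeta d rr r) phi_is_monoid_morphism.

Lemma theta_is_zmod_morphism : zmod_morphism (theta etaL).
Proof. by move=> p p'; rewrite /theta rmorphB hornerD hornerN. Qed.

Lemma theta_is_monoid_morphism : monoid_morphism (theta etaL).
Proof. by split=> [|p p']; rewrite /theta ?rmorph1 ?hornerC // rmorphM hornerM. Qed.

HB.instance Definition _ := GRing.isZmodMorphism.Build {poly K} L
  (theta etaL) theta_is_zmod_morphism.
HB.instance Definition _ := GRing.isMonoidMorphism.Build {poly K} L
  (theta etaL) theta_is_monoid_morphism.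

Lemma thetaX : theta etaL 'X = etaL.
Proof. by rewrite /theta map_polyX hornerX. Qed.

Lemma thetaC c : theta etaL c%:P = c%:A.
Proof. by rewrite /theta map_polyC hornerC. Qed.

Let X_neq0 : (tofrac 'X : Ky K) != 0. Proof. by rewrite tofrac_eq0 polyX_eq0. Qed.

Lemma phiq_neq0 : phiq K r != 0.
Proof. exact: expfz_neq0. Qed.

Lemma phiQ_neq0 a : zeta != 0 -> phiQ zeta d rr a != 0.
Proof.
move=> z0; apply: mulf_neq0; last exact: expfz_neq0.
by rewrite tofrac_eq0 polyC_eq0; do 2!apply: expf_neq0.
Qed.

Let phi_gen (a : 'I_l.+1) : phi zeta d rr r (mpolyX K (mnm1 a)) =
  if (a < l)%N then phiQ zeta d rr a else phiq K r.
Proof. by rewrite phiE mmapX mmap1U. Qed.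

Lemma genq_specialises : specialises (phi zeta d rr r) (genq K l) (phiq K r).
Proof.
have := specialises_tofrac (phi zeta d rr r) (mpolyX K (mnm1 (inord l : 'I_l.+1))).
by rewrite /= phi_gen inordK // ltnn.
Qed.

Lemma genQ_specialises a : (a < l)%N ->
  specialises (phi zeta d rr r) (genQ K l a) (phiQ zeta d rr a).
Proof.
move=> al; have := specialises_tofrac (phi zeta d rr r) (mpolyX K (mnm1 (inord a : 'I_l.+1))).
by rewrite /= phi_gen inordK ?al // ltnW.
Qed.

Lemma gen_zd_specialises :
  specialises (phi zeta d rr r) (gen_zd zeta l) (tofrac (zeta ^+ l)%:P).
Proof.
have := specialises_tofrac (phi zeta d rr r) (mpolyC l.+1 (zeta ^+ l)).
by rewrite /= phiE mmapC.
Qed.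

Lemma genq_neq0 : genq K l != 0.
Proof.
rewrite tofrac_eq0; apply: contra_neq phiq_neq0 => X0.
by have := phi_gen (inord l); rewrite X0 rmorph0 inordK // ltnn.
Qed.

End PhiTheta.

(** * The primitive roots of unity *)

Lemma cis_power (R : realType) (x : R) (k : nat) :
  (cos x +i* sin x)%C ^+ k = (cos (k%:R * x) +i* sin (k%:R * x))%C.
Proof.
elim: k => [|k IH]; first by rewrite expr0 mul0r cos0 sin0.
have -> : k.+1%:R * x = x + k%:R * x by rewrite -addn1 natrD mulrDl mul1r addrC.
rewrite exprS IH cosD sinD; apply/eqP; rewrite eq_complex /= eqxx /=.
by apply/eqP; ring.
Qed.

(** Here 1 - cos x is twice the square of sin (x / 2). *)
Lemma cos_lt1 (R : realType) (x : R) : 0 < x < 2 * pi -> cos x != 1.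
Proof.
move=> x02; pose y := x / 2.
have -> : x = y + y by rewrite /y; field.
have sy : 0 < sin y by apply: sin_gt0_pi; move: x02; rewrite /y; lra.
rewrite cosD; have := cos2Dsin2 y => cs; apply/eqP => c1.
have : sin y * sin y = 0 by move: cs c1; rewrite !expr2; lra.
by move/eqP; rewrite mulf_eq0 orbb gt_eqF.
Qed.

Lemma exp2pi_primitive (R : realType) m : (0 < m)%N -> m.-primitive_root (exp2pi R m).
Proof.
move=> m0; have mR : 0 < m%:R :> R by rewrite ltr0n.
have exp_m : exp2pi R m ^+ m = 1.
  rewrite cis_power (_ : m%:R * (2 * pi / m%:R) = pi *+ 2); last by field; rewrite gt_eqF.
  by rewrite cos2pi sin2pi.
have [k kprim km] := prim_order_exists m0 exp_m.
have k0 := prim_order_gt0 kprim.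
suff mk : m = k by rewrite {1}mk.
apply/eqP; rewrite eqn_leq (dvdn_leq m0 km) andbT leqNgt; apply/negP => ltkm.
have := prim_expr_order kprim; rewrite cis_power => /eqP; rewrite eq_complex /= => /andP[ck _].
have : cos (k%:R * (2 * pi / m%:R)) != 1 :> R; last by rewrite ck.
have p0 := pi_gt0 R; have kR : 0 < k%:R :> R by rewrite ltr0n.
apply: cos_lt1; apply/andP; split.
  by rewrite mulr_gt0 // divr_gt0 // mulr_gt0.
rewrite mulrCA -[X in _ < X]mulr1 ltr_pM2l ?mulr_gt0 //.
by rewrite ltr_pdivrMr // mul1r ltr_nat.
Qed.

(** * Blocks and defect *)

Section Blocks.
Variables (K : fieldExtType rat) (L : fieldExtType K) (zeta : K) (etaL : L).
Variables (d l n : nat) (rr : l.-tuple int) (r : int).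
Hypotheses (d_gt0 : (0 < d)%N) (l_gt0 : (0 < l)%N).
Hypothesis zeta_prim : (d * l).-primitive_root zeta.
Hypothesis etaL_neq0 : etaL != 0.
Local Notation qK := (phiq K r).
Local Notation qL := (thetaq etaL r).
Local Notation QL := (thetaQ zeta etaL d rr).
Local Notation spec := (specialises (theta etaL)).

Let zetal_prim : d.-primitive_root (zeta ^+ l).
Proof. by have := dvdn_prim_root zeta_prim (dvdn_mulr l (dvdnn d)); rewrite mulKn. Qed.

Let Ky_natr_eq0 m : (m%:R == 0 :> Ky K) = (m == 0%N).
Proof.
rewrite -(rmorph_nat (@tofrac {poly K} \o polyC)) fmorph_eq0.
exact: natr_fieldExt_eq0.
Qed.

Let zK_prim : d.-primitive_root (tofrac (zeta ^+ l)%:P : Ky K).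
Proof. by rewrite (fmorph_primitive_root (@tofrac {poly K} \o polyC)). Qed.

Let qK_spec : spec qK qL.
Proof.
apply: specialisesXz => //.
by have := specialises_tofrac (theta etaL) 'X; rewrite /= thetaX.
Qed.

Let qL_neq0 : qL != 0. Proof. exact: expfz_neq0. Qed.

(** The scalar on V comes from a joint eigenvector, that on M by reduction. *)
Lemma central_mx_edge (V : rep (Ky K) (yh_gen n)) (M : rep L (yh_gen n)) m s :
  yh_module qK (phiQ zeta d rr) d l V -> is_simple V -> is_simple M ->
  decomposition_number (theta etaL) V M != 0%N ->
  exists x y, [/\ central_mx qK V m s = x%:M, spec x y & central_mx qL M m s = y%:M].
Proof.
move=> VY Vs [Mpos _] VM.
have d0 : d%:R != 0 :> Ky K by rewrite Ky_natr_eq0 -lt0n.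
have [x Vx] := central_mx_scalar (phiq_neq0 K r) VY m s Vs d0 zK_prim.
by have [y xy My] := central_mx_decomposition qL_neq0 qK_spec VM Mpos Vx; exists x, y.
Qed.

(** The reduction at Phi of the character by which the central elements act. *)
Definition central_character (V : rep (Ky K) (yh_gen n)) (c : nat -> nat -> L) : Prop :=
  forall m s, exists2 x, central_mx qK V m s = x%:M & spec x (c m s).

Lemma scalar_mx_inj (F : fieldType) N (x y : F) : (0 < N)%N -> x%:M = y%:M :> 'M_N -> x = y.
Proof. by move=> N0 /matrixP /(_ (Ordinal N0) (Ordinal N0)); rewrite !mxE eqxx. Qed.

(** The characters of V and V' both reduce to that of M. *)
Lemma central_character_edge V V' c :
  (exists M : rep L (yh_gen n), [/\ is_simple M,
     decomposition_number (theta etaL) V M != 0%N &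
     decomposition_number (theta etaL) V' M != 0%N]) ->
  yh_module qK (phiQ zeta d rr) d l V -> is_simple V ->
  yh_module qK (phiQ zeta d rr) d l V' -> is_simple V' ->
  central_character V c -> central_character V' c.
Proof.
move=> [M [Ms VM V'M]] VY Vs V'Y V's Vc m s.
have [x Vx xc] := Vc m s.
have [x1 [y [Vx1 xy My]]] := central_mx_edge m s VY Vs Ms VM.
have [x' [y' [V'x x'y' My']]] := central_mx_edge m s V'Y V's Ms V'M.
exists x' => //; suff -> : c m s = y' by [].
have x1E : x1 = x by apply: (scalar_mx_inj (proj1 Vs)); rewrite -Vx -Vx1.
have yE : y' = y by apply: (scalar_mx_inj (proj1 Ms)); rewrite -My -My'.
by rewrite yE; apply: specialises_inj xc _; rewrite -x1E.
Qed.

Lemma central_character_block V V' : same_theta_block zeta etaL d rr r V V' ->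
  forall c, central_character V c <-> central_character V' c.
Proof.
elim=> [W W' [[WY Ws] [W'Y W's] [M [MY Ms WM W'M]]] c|W c|W W' _ IH c|W W' W'' _ IH _ IH' c].
- by split; apply: central_character_edge => //; exists M.
- by [].
- by split=> /IH.
- by split=> [/IH/IH'|/IH'/IH].
Qed.

Definition residue_character (lam : seq (seq nat)) (m s : nat) : L :=
  \sum_(i < d) \sum_(x <- nodes (mblock l lam i)) content qL QL x ^+ m * ((zeta ^+ l)%:A ^+ i) ^+ s.

Lemma phiQ_specialises a : spec (phiQ zeta d rr a) (QL a).
Proof.
apply: specialisesM.
  by have := specialises_tofrac (theta etaL) ((zeta ^+ d) ^+ a)%:P; rewrite /= thetaC.
apply: specialisesXz => //.
by have := specialises_tofrac (theta etaL) 'X; rewrite /= thetaX.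
Qed.

(** V and the generic module V0 have the same traces up to specialisation, and the
    scalars on V0 are known. *)
Lemma central_character_labelled lam V : is_multipartition (d * l) n lam ->
  phi_labelled zeta d rr r lam V -> central_character V (residue_character lam).
Proof.
move=> lamP [VY Vs [V0 [V0lam trw]]] m s.
have d0 : d%:R != 0 :> Ky K by rewrite Ky_natr_eq0 -lt0n.
have [y Vy] := central_mx_scalar (phiq_neq0 K r) VY m s Vs d0 zK_prim.
exists y => //.
have V0x := central_mx_labelled (genq_neq0 zeta d rr r) lamP V0lam m s.
have zeta0 := primitive_root_neq0 zeta_prim.
have xx := content_sum_specialises (phiq_neq0 K r) (genq_specialises zeta d rr r)
  (genQ_specialises zeta d rr r) m s lamP (gen_zd_specialises zeta d rr r).
rewrite (central_mx_trace Ky_natr_eq0 (phiq_neq0 K r) (genq_specialises zeta d rr r)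
  (proj1 Vs) trw V0x xx Vy).
apply: (content_sum_specialises qL_neq0 qK_spec) lamP _ => [a _|]; first exact: phiQ_specialises.
by have := specialises_tofrac (theta etaL) (zeta ^+ l)%:P; rewrite /= thetaC.
Qed.

Lemma same_block_residues lam mu (V V' : rep (Ky K) (yh_gen n)) :
  is_multipartition (d * l) n lam -> is_multipartition (d * l) n mu ->
  phi_labelled zeta d rr r lam V -> phi_labelled zeta d rr r mu V' ->
  same_theta_block zeta etaL d rr r V V' ->
  forall i : 'I_d, perm_eq (residues qL QL (mblock l lam i)) (residues qL QL (mblock l mu i)).
Proof.
move=> lamP muP Vlam V'mu VV'.
have V'lam := proj1 (central_character_block VV' _) (central_character_labelled lamP Vlam).
have V'mu' := central_character_labelled muP V'mu.
have V'pos : (0 < rdim V')%N by case: V'mu => _ [].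
have L_natr m : (m%:R == 0 :> L) = (m == 0%N).
  by rewrite -(rmorph_nat (in_alg L)) fmorph_eq0 natr_fieldExt_eq0.
apply: (colored_power_sums_perm L_natr (z := (zeta ^+ l)%:A)) => [|m s].
  by rewrite (fmorph_primitive_root (in_alg L)).
have [x Vx xc] := V'lam m s; have [x' Vx' xc'] := V'mu' m s.
have xE : x' = x by apply: (scalar_mx_inj V'pos); rewrite -Vx -Vx'.
have cE := specialises_inj xc; rewrite -xE in cE; have {}cE := cE _ xc'.
under eq_bigr => i _ do rewrite big_map.
by under [RHS]eq_bigr => i _ do rewrite big_map.
Qed.

Variable Phi : {poly K}.
Hypothesis Phi_neq0 : Phi != 0.
Hypothesis PhiE : forall p, (Phi %| p) = (theta etaL p == 0).

(** By definition the Schur element is generic; its specialisation by phi is the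
    same expression in the specialised parameters, whose factors are binomials. *)
Lemma defect_residues lam : is_multipartition (d * l) n lam ->
  defect zeta d n rr r Phi lam = \sum_(i < d)
    (hook_weight qL QL l (mblock l lam i) - (qL == 1)%:Z * (size (nodes (mblock l lam i)))%:Z).
Proof.
move=> lamP.
have zeta0 := primitive_root_neq0 zeta_prim.
have zetad_prim : l.-primitive_root (zeta ^+ d).
  by have := dvdn_prim_root zeta_prim (dvdn_mull d (dvdnn l)); rewrite mulnK.
have thX : theta etaL 'X != 0 by rewrite thetaX.
rewrite /defect (specialiseE (yh_schur_specialises (phiq_neq0 K r)
  (fun a _ => phiQ_neq0 d rr a zeta0) (genq_specialises zeta d rr r)
  (genQ_specialises zeta d rr r) d n lam)).
apply: (valuationE Phi_neq0 PhiE thX); rewrite -[X in has_valuation _ _ X]add0r.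
apply: (has_valuationM Phi_neq0 PhiE).
  apply: (has_valuation_unit PhiE (z := d%:R ^+ n)).
    by rewrite expf_neq0 // -(rmorph_nat (in_alg L)) fmorph_eq0 natr_fieldExt_eq0 -lt0n.
  by apply: specialisesXn; apply: specialises_nat.
apply: (has_valuation_prod Phi_neq0 PhiE) => i _.
have [sl al] := mblock_multipartition lamP (ltn_ord i).
have := has_valuation_ak_schur Phi_neq0 PhiE thX (fun a => rr`_a) r zetad_prim sl al.
have -> : residual_Q (theta etaL) (zeta ^+ d) (fun a => rr`_a) = QL.
  by apply/funext => a; rewrite /residual_Q /thetaQ /= thetaX thetaC.
by rewrite /residual_q /= thetaX.
Qed.

Theorem same_block_defect lam mu (V V' : rep (Ky K) (yh_gen n)) :
  is_multipartition (d * l) n lam -> is_multipartition (d * l) n mu ->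
  phi_labelled zeta d rr r lam V -> phi_labelled zeta d rr r mu V' ->
  same_theta_block zeta etaL d rr r V V' ->
  defect zeta d n rr r Phi lam = defect zeta d n rr r Phi mu.
Proof.
move=> lamP muP Vlam V'mu VV'; rewrite !defect_residues //.
apply: eq_bigr => i _; have res := same_block_residues lamP muP Vlam V'mu VV' i.
have [sl al] := mblock_multipartition lamP (ltn_ord i).
have [sm am] := mblock_multipartition muP (ltn_ord i).
congr (_ - _ * _); last by have := perm_size res; rewrite !size_map => ->.
have wl := hook_weight_residues QL qL_neq0 sl al.
have wm := hook_weight_residues QL qL_neq0 sm am.
by apply: (@mulIf _ 2%:R) => //; rewrite !mulr_natr wl wm; apply: residue_weight_perm.
Qed.

End Blocks.

(* K is Q(eta_dl) and L is K(eta), both embedded in the complex numbers. *)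
Theorem theorem6p1p1 (R : realType) (n d l : nat) (d_gt0 : (0 < d)%N)
    (l_gt0 : (0 < l)%N)
    (K : fieldExtType rat) (L : fieldExtType K) (iota : {rmorphism L -> R[i]})
    (zeta : K) (zetaE : iota zeta%:A = exp2pi R (d * l))
    (K_gen : <<1; zeta>>%VS = fullv)
    (rr : l.-tuple int) (r : int)
    (eta : R[i]) (eta_neq0 : eta != 0)
    (etaL : L) (etaLE : iota etaL = eta) (L_gen : <<1; etaL>>%VS = fullv)
    (Phi : {poly K}) (Phi_monic : Phi \is monic)
    (Phi_irr : irreducible_poly Phi)
    (Phi_eta : root (map_poly (fun c : K => iota c%:A) Phi) eta)
    (lam mu : seq (seq nat))
    (lam_part : is_multipartition (d * l) n lam)
    (mu_part : is_multipartition (d * l) n mu)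
    (V V' : rep (Ky K) (yh_gen n))
    (V_lam : phi_labelled zeta d rr r lam V)
    (V'_mu : phi_labelled zeta d rr r mu V') :
  same_theta_block zeta etaL d rr r V V' ->
  defect zeta d n rr r Phi lam = defect zeta d n rr r Phi mu.
Proof.
have zeta_prim : (d * l).-primitive_root zeta.
  rewrite -(fmorph_primitive_root (iota \o in_alg L)) /= zetaE.
  by apply: exp2pi_primitive; rewrite muln_gt0 d_gt0.
have etaL_neq0 : etaL != 0 by rewrite -(fmorph_eq0 iota) etaLE.
have Phi_root : root (map_poly (in_alg L) Phi) etaL.
  rewrite -(fmorph_root iota) etaLE -map_poly_comp.
  exact: Phi_eta.
have PhiE p : (Phi %| p) = (theta etaL p == 0).
  apply/idP/idP => [/dvdpP[u ->]|].
    by rewrite rmorphM /= [X in _ * X](eqP Phi_root) mulr0.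
  apply: contraTT; rewrite -irreducible_poly_coprime // => cop.
  by apply: coprimep_root Phi_root; rewrite coprimep_map.
exact: (same_block_defect d_gt0 l_gt0 zeta_prim etaL_neq0 (irredp_neq0 Phi_irr) PhiE
  lam_part mu_part V_lam V'_mu).
Qed.
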